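(* For $0<\theta<1$ and $p=\frac{2}{2-\theta}$ (so $1\le p\le 2$), we have $$(l^1(\mathrm L),l^2(\mathrm L))_{\theta,p}=l^p(\mathrm L),\qquad (l^1(\mathrm L^* ),l^2(\mathrm L^* ))_{\theta,p}=l^p(\mathrm L^* ).$$
   Context: Setting. $\Omega\subset\mathbb R^n$ ($n\ge 1$) is a bounded open set. $\mathrm L$ is a differential operator of order $m$ with smooth coefficients in $\Omega$, equipped with linear boundary conditions (the functions satisfying them form a linear space), viewed as an operator in $L^2(\Omega)$ with domain $\mathrm{Dom}(\mathrm L)$; $\mathrm L^*$ is its adjoint, with the adjoint boundary conditions and domain $\mathrm{Dom}(\mathrm L^* )$. $\mathcal I$ is a countable subset of some $\mathbb Z^K$; $\mathrm L$ has discrete spectrum $\{\lambda_\xi\}_{\xi\in\mathcal I}\subset\mathbb C$, listed with multiplicities so that $|\lambda_j|\le|\lambda_k|$ whenever $|j|\le|k|$. There are eigenfunctions $u_\xi\in\mathrm{Dom}(\mathrm L)$, $\mathrm Lu_\xi=\lambda_\xi u_\xi$, and $v_\xi\in\mathrm{Dom}(\mathrm L^* )$, $\mathrm L^*v_\xi=\overline{\lambda_\xi}v_\xi$, with $\|u_\xi\|_{L^2}=1$ and $(u_\xi,v_\eta)_{L^2}=\delta_{\xi\eta}$, where $(f,g)_{L^2}=\int_\Omega f\overline g\,dx$; both $\{u_\xi\}$ and $\{v_\xi\}$ are Riesz bases of $L^2(\Omega)$. Put $\langle\xi\rangle=(1+|\lambda_\xi|^2)^{1/(2m)}$. Boundary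 conditions are preserved under limits (the spaces $\bigcap_k\mathrm{Dom}(\mathrm L^k)$ and $\bigcap_k\mathrm{Dom}((\mathrm L^* )^k)$ with norms $\max_{j\le k}\|\mathrm L^j\varphi\|_{L^2}$, resp. $\max_{j\le k}\|(\mathrm L^* )^j\varphi\|_{L^2}$, are complete). $\mathcal S'(\mathcal I)$ is the set of $a:\mathcal I\to\mathbb C$ with $|a(\xi)|\le C\langle\xi\rangle^M$ for some $C,M$. For $1\le p\le2$, $l^p(\mathrm L)$ is the space of $a\in\mathcal S'(\mathcal I)$ with $\|a\|_{l^p(\mathrm L)}=(\sum_\xi|a(\xi)|^p\|u_\xi\|_{L^\infty(\Omega)}^{2-p})^{1/p}<\infty$, and $l^p(\mathrm L^* )$ the space of $b\in\mathcal S'(\mathcal I)$ with $\|b\|_{l^p(\mathrm L^* )}=(\sum_\xi|b(\xi)|^p\|v_\xi\|_{L^\infty(\Omega)}^{2-p})^{1/p}<\infty$. These definitions presuppose $u_\xi,v_\xi\in L^\infty(\Omega)$. $(X_0,X_1)_{\theta,p}$ denotes the real interpolation space; equality of spaces is with equivalent norms. *)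

(* Defs.v *)
From HB Require Import structures.
From mathcomp Require Import all_boot all_order all_algebra.
From mathcomp Require Import complex.
From mathcomp Require Import all_classical all_reals all_analysis.
From mathcomp Require Import ess_sup_inf.
Set Implicit Arguments.
Unset Strict Implicit.
Unset Printing Implicit Defensive.
Import Order.TTheory GRing.Theory Num.Theory.
Import numFieldNormedType.Exports.
Local Open Scope classical_set_scope.
Local Open Scope ring_scope.

(* R^n is 'rV[R]_n, equipped with its Borel sigma-algebra. *)
Section borel_rV.
Context (R : realType) (n : nat).

Let borel : set (set 'rV[R]_n) := <<s (@open 'rV[R]_n) >>.

HB.instance Definition _ :=
  @isMeasurable.Build (sigma_display (@open 'rV[R]_n)) 'rV[R]_n borel
    (@sigma_algebra0 _ setT _) (@sigma_algebraC _ _)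
    (@sigma_algebra_bigcup _ setT _).

End borel_rV.

Section lebesgue_measure_rV.
Context (R : realType).
Definition rv_of_tuple n (x : n.-tuple R) : 'rV[R]_n := \row_i tnth x i.

Lemma measurable_rv_of_tuple n :
  measurable_fun [set: n.-tuple R] (@rv_of_tuple n).
Proof.
pose box (q : {ffun 'I_n -> rat} * rat) : set 'rV[R]_n :=
  [set v | forall i, `|v ord0 i - ratr (q.1 i)| < ratr q.2].
have mbox q : measurable (@rv_of_tuple n @^-1` box q).
  have -> : @rv_of_tuple n @^-1` box q =
      \bigcap_(i in [set: 'I_n]) ((fun x : n.-tuple R => tnth x i) @^-1`
         `](ratr (q.1 i) - ratr q.2), (ratr (q.1 i) + ratr q.2)[%classic).
    apply/seteqP; split => x /=.
      by move=> h i _ /=; have := h i; rewrite mxE ltr_distl in_itv.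
    by move=> h i; have := h i I; rewrite /= mxE ltr_distl in_itv.
  apply: fin_bigcap_measurable => // i _.
  rewrite -[X in measurable X]setTI.
  exact: measurable_tnth.
apply: (measurability (@open 'rV[R]_n)) => //.
move=> _ [A oA <-]; rewrite setTI.
have -> : @rv_of_tuple n @^-1` A =
    \bigcup_(q in [set q | box q `<=` A]) (@rv_of_tuple n @^-1` box q).
  apply/seteqP; split => [x /= Ax|x [q qA /qA//]].
  have := oA; rewrite openE => /(_ _ Ax); rewrite /interior /= -nbhs_ballE.
  move=> [e /= e0 eA].
  have [r r0 re] : exists2 r : rat, (0 : R) < ratr r & ratr r < e / 2.
    have [|r] := @rat_in_itvoo R 0 (e / 2); first by rewrite divr_gt0.
    by rewrite in_itv /= => /andP[]; exists r.
  have hq i : exists q : rat, `|tnth x i - ratr q| < ratr r.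
    have [|q] := @rat_in_itvoo R (tnth x i - ratr r) (tnth x i + ratr r).
      by rewrite ltrBlDr -addrA ltrDl addr_gt0.
    by rewrite in_itv /= -ltr_distl distrC; exists q.
  have /choice[q hq'] := hq.
  exists ([ffun i => q i], r) => /=; last by move=> i /=; rewrite ffunE mxE.
  move=> v hv; apply: eA; split => // i j /=; rewrite (ord1 i) mxE -ball_normE /=.
  have := hv j; rewrite /= ffunE => hvj.
  rewrite (le_lt_trans (ler_distD (ratr (q j)) _ _))//.
  rewrite (splitr e) ltrD// ?(lt_trans (hq' j))//.
  by rewrite distrC (lt_trans hvj).
rewrite bigcup_mkcond; apply: countable_bigcupT_measurable => [|q]; first exact: countableP.
by case: ifPn => // _; exact: mbox.
Qed.


Definition cons_tuple n (p : n.-tuple R * R) : n.+1.-tuple R :=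
  [tuple of p.2 :: p.1].

Lemma measurable_cons_tuple n : measurable_fun setT (@cons_tuple n).
Proof. exact: (measurable_cons measurable_snd measurable_fst). Qed.

Definition image_measure d d' (T : measurableType d) (T' : measurableType d')
    (mu : {measure set T -> \bar R}) (f : T -> T')
    (mf : measurable_fun setT f) : {measure set T' -> \bar R} :=
  measure_function_pushforward__canonical__measure_function_Measure mu mf.

Fixpoint lebesgue_tuple n : {measure set (n.-tuple R) -> \bar R} :=
  match n with
  | 0 => \d_[tuple]
  | n.+1 =>
    image_measure (product_measure1 (lebesgue_tuple n) lebesgue_measure)
      (@measurable_cons_tuple n)
  end.

Definition lebesgue_rV n : {measure set 'rV[R]_n -> \bar R} :=
  image_measure (lebesgue_tuple n) (@measurable_rv_of_tuple n).

Lemma lebesgue_rV_box n (A : 'I_n -> set R) :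
  (forall i, measurable (A i)) ->
  lebesgue_rV n [set v | forall i, A i (v ord0 i)] =
  (\prod_(i < n) lebesgue_measure (A i))%E.
Proof.
move=> mA; rewrite /lebesgue_rV /= /pushforward.
have -> : @rv_of_tuple n @^-1` [set v | forall i, A i (v ord0 i)] =
          [set x | forall i, A i (tnth x i)].
  by apply/seteqP; split => x /= h i; have := h i; rewrite mxE.
elim: n => [|n IHn] in A mA *.
  by rewrite big_ord0 /= diracE mem_set//= => -[].
rewrite big_ord_recl /= /pushforward.
have -> : @cons_tuple n @^-1` [set x | forall i, A i (tnth x i)] =
    [set x | forall i, A (lift ord0 i) (tnth x i)] `*` A ord0.
  apply/seteqP; split => [[x t] /= h|[x t] /= [h1 h2] i].
    split; first by move=> i; have := h (lift ord0 i); rewrite /= tnthS.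
    by have := h ord0; rewrite /= tnth0.
  by case: (unliftP ord0 i) => [j|] ->; rewrite ?tnthS ?tnth0.
have mbox : measurable
    [set x : n.-tuple R | forall i, A (lift ord0 i) (tnth x i)].
  have -> : [set x : n.-tuple R | forall i, A (lift ord0 i) (tnth x i)] =
      \bigcap_(i in [set: 'I_n])
        ((fun x : n.-tuple R => tnth x i) @^-1` A (lift ord0 i)).
    by apply/seteqP; split => x /= h i => [_|]; apply: h.
  apply: fin_bigcap_measurable => // i _.
  by rewrite -[X in measurable X]setTI; exact: measurable_tnth.
rewrite product_measure1E; [|exact: mbox|exact: mA].
by rewrite muleC; congr (_ * _)%E; exact: (IHn (fun i => A (lift ord0 i))).

Qed.

End lebesgue_measure_rV.

Notation normc := ComplexField.Normc.normc.

(* Elements of L^2(Omega) are represented by functions on R^n whose values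
   outside Omega are irrelevant; equality in L^2(Omega) is eq_ae. *)
Section L2.
Context (R : realType) (n : nat) (Omega : set 'rV[R]_n).
Implicit Types f g : 'rV[R]_n -> R[i].

Definition eq_ae f g : Prop := ae_eq (lebesgue_rV R n) Omega f g.

Definition sqnorm f : \bar R :=
  (\int[lebesgue_rV R n]_(x in Omega) (normc (f x) ^+ 2)%:E)%E.

Definition L2 : set ('rV[R]_n -> R[i]) :=
  [set f | [/\ measurable_fun Omega (fun x => complex.Re (f x)),
               measurable_fun Omega (fun x => complex.Im (f x))
             & (sqnorm f < +oo)%E]].

Definition l2norm f : R := Num.sqrt (fine (sqnorm f)).

Definition cintegral f : R[i] :=
  Complex (\int[lebesgue_rV R n]_(x in Omega) complex.Re (f x))
          (\int[lebesgue_rV R n]_(x in Omega) complex.Im (f x)).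

Definition inner f g : R[i] := cintegral (fun x => f x * conjc (g x)).

Definition Linfty_norm f : \bar R :=
  ess_sup (lebesgue_rV R n) ((fun x => (normc (f x))%:E) \_ Omega).

Definition riesz_basis (I : choiceType) (e : I -> 'rV[R]_n -> R[i]) : Prop :=
  [/\ forall i, L2 (e i),
      exists A B : R, [/\ 0 < A, 0 < B &
        forall (s : seq I) (c : I -> R[i]), uniq s ->
          let S := \sum_(i <- s) normc (c i) ^+ 2 in
          A * S <= l2norm (fun x => \sum_(i <- s) c i * e i x) ^+ 2 <= B * S]
    & forall f, L2 f -> forall eps : R, 0 < eps ->
        exists (s : seq I) (c : I -> R[i]),
          l2norm (fun x => f x - \sum_(i <- s) c i * e i x) < eps].

End L2.

Section operators.
Context (R : realType) (n : nat).
Local Notation F := ('rV[R]_n -> R[i]).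

(* [app T f] is only meaningful for [f] in [dom T]. *)
Record operator := Operator { dom : set F ; app : F -> F }.

Context (Omega : set 'rV[R]_n).
Local Notation "f =ae g" := (eq_ae Omega f g) (at level 70).

Definition linear_operator_L2 (T : operator) : Prop :=
  [/\ forall f, dom T f -> L2 Omega f /\ L2 Omega (app T f),
      forall f g, dom T f -> L2 Omega g -> f =ae g ->
        dom T g /\ app T f =ae app T g,
      dom T 0
    & forall (c : R[i]) f g, dom T f -> dom T g ->
        dom T (fun x => c * f x + g x) /\
        app T (fun x => c * f x + g x) =ae
          (fun x => c * app T f x + app T g x)].

Definition adjoint (T : operator) : operator :=
  let is_adj g h :=
    L2 Omega h /\
    forall f, dom T f -> inner Omega (app T f) g = inner Omega f h in
  Operator [set g | L2 Omega g /\ exists h, is_adj g h]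
           (fun g => xget 0 [set h | is_adj g h]).

Definition eigenfunction (T : operator) (z : R[i]) (f : F) : Prop :=
  dom T f /\ app T f =ae (fun x => z * f x).

(* T - z is a bijection of dom T onto L^2 with bounded inverse: the first
   condition gives injectivity and the bound, the second surjectivity. *)
Definition in_resolvent (T : operator) (z : R[i]) : Prop :=
  (exists C : R, forall f, dom T f ->
     l2norm Omega f <= C * l2norm Omega (fun x => app T f x - z * f x)) /\
  (forall g, L2 Omega g ->
     exists2 f, dom T f & (fun x => app T f x - z * f x) =ae g).

Definition spectrum (T : operator) : set R[i] :=
  [set z | ~ in_resolvent T z].

(* For a Riesz basis of eigenfunctions with eigenvalues lam, the number of
   occurrences of z in lam is automatically the multiplicity of z. *)
Definition discrete_spectrum (T : operator) (I : Type) (lam : I -> R[i]) :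
    Prop :=
  [/\ spectrum T = range lam,
      forall z, spectrum T z -> exists2 eps : R, 0 < eps &
        forall w, spectrum T w -> normc (w - z) < eps -> w = z
    & forall z, finite_set [set xi | lam xi = z]].

Definition dom_infty (T : operator) : set F :=
  [set f | forall k, dom T (iter k (app T) f)].

Definition graph_norm (T : operator) (k : nat) (f : F) : R :=
  \big[Num.max/0]_(j < k.+1) l2norm Omega (iter j (app T) f).

Definition complete_dom_infty (T : operator) : Prop :=
  forall phi : nat -> F, (forall i, dom_infty T (phi i)) ->
    (forall k (eps : R), 0 < eps -> exists N, forall i j,
       (N <= i)%N -> (N <= j)%N -> graph_norm T k (phi i - phi j) < eps) ->
    exists2 psi, dom_infty T psi &
      forall k, graph_norm T k (phi i - psi) @[i --> \oo] --> (0 : R).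

End operators.

Section differential_operators.
Context (R : realType) (n : nat).
Implicit Types f g : 'rV[R]_n -> R[i].

Definition partial (i : 'I_n) f : 'rV[R]_n -> R[i] := fun x =>
  Complex ('D_(delta_mx 0 i) (fun y => complex.Re (f y)) x)
          ('D_(delta_mx 0 i) (fun y => complex.Im (f y)) x).

Definition smooth_on (U : set 'rV[R]_n) f : Prop :=
  forall (s : seq 'I_n) x, U x ->
    let g := foldr partial f s in
    [/\ {for x, continuous (fun y => complex.Re (g y))},
        {for x, continuous (fun y => complex.Im (g y))},
        forall i, derivable (fun y => complex.Re (g y)) x (delta_mx 0 i)
      & forall i, derivable (fun y => complex.Im (g y)) x (delta_mx 0 i)].

Definition test_function (U : set 'rV[R]_n) f : Prop :=
  let supp := closure [set x | f x != 0] in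
  [/\ smooth_on setT f, compact supp & supp `<=` U].

(* Multi-indices with entries at most m. *)
Definition mindex (m : nat) := {ffun 'I_n -> 'I_m.+1}.

Definition mdegree m (al : mindex m) : nat := \sum_i al i.

Definition mpartial m (al : mindex m) f : 'rV[R]_n -> R[i] :=
  foldr (fun i => iter (al i) (partial i)) f (enum 'I_n).

(* T f = \sum_(|al| <= m) coef al * D^al f in the sense of distributions on
   Omega, for every f in dom T. *)
Definition differential_operator (Omega : set 'rV[R]_n) (m : nat)
    (coef : mindex m -> 'rV[R]_n -> R[i]) (T : operator R n) : Prop :=
  [/\ forall al, (mdegree al <= m)%N -> smooth_on Omega (coef al),
      exists al, mdegree al = m /\ exists2 x, Omega x & coef al x != 0
    & forall f, dom T f -> forall phi, test_function Omega phi ->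
        cintegral Omega (fun x => app T f x * phi x) =
        \sum_(al : mindex m | (mdegree al <= m)%N)
          (-1) ^+ mdegree al *
          cintegral Omega
            (fun x => f x * mpartial al (fun y => coef al y * phi y) x)].

End differential_operators.

Section interpolation.
Context (R : realType).
Local Open Scope ereal_scope.

(* A linear subspace of V with its norm, which is only meaningful on the
   subspace. *)
Record normed_subspace (V : Type) :=
  NormedSubspace { carrier : set V ; nsnorm : V -> \bar R }.

Context (V : zmodType).
Implicit Types X Y : normed_subspace V.

Definition K_functional X0 X1 (t : R) (a : V) : \bar R :=
  ereal_inf [set y | exists a0 a1, [/\ carrier X0 a0, carrier X1 a1,
    a = (a0 + a1)%R & y = nsnorm X0 a0 + t%:E * nsnorm X1 a1]].

Definition interpolation_norm (theta p : R) X0 X1 (a : V) : \bar R :=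
  (\int[lebesgue_measure]_(t in `]0%R, +oo[%classic)
     (((t `^ (- theta))%:E * K_functional X0 X1 t a) `^ p * (t^-1)%:E))
  `^ (p^-1).

Definition real_interpolation (theta p : R) X0 X1 : normed_subspace V :=
  NormedSubspace
    [set a | (exists a0 a1, [/\ carrier X0 a0, carrier X1 a1 &
                a = (a0 + a1)%R]) /\
             interpolation_norm theta p X0 X1 a < +oo]
    (interpolation_norm theta p X0 X1).

Definition equal_with_equivalent_norms X Y : Prop :=
  carrier X = carrier Y /\
  exists2 C : R, (0 < C)%R & forall a, carrier X a ->
    nsnorm X a <= C%:E * nsnorm Y a /\ nsnorm Y a <= C%:E * nsnorm X a.

End interpolation.

Section sequence_spaces.
Context (R : realType) (I : choiceType) (m : nat) (lam : I -> R[i]).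

Definition jbracket (xi : I) : R :=
  (1 + normc (lam xi) ^+ 2) `^ ((2 * m)%:R^-1).

Definition tempered : set (I -> R[i]) :=
  [set a | exists C M : R, forall xi, normc (a xi) <= C * jbracket xi `^ M].

Context (n : nat) (Omega : set 'rV[R]_n) (u : I -> 'rV[R]_n -> R[i]).

Definition lp_norm (p : R) (a : I -> R[i]) : \bar R :=
  ((\esum_(xi in [set: I])
      ((normc (a xi) `^ p)%:E * Linfty_norm Omega (u xi) `^ (2 - p))) `^ (p^-1))%E.

Definition lp (p : R) : normed_subspace R (I -> R[i]) :=
  NormedSubspace [set a | tempered a /\ (lp_norm p a < +oo)%E] (lp_norm p).

End sequence_spaces.

(* Main.v *)
Require Import Defs.
From mathcomp Require Import all_boot all_order all_algebra.
From mathcomp Require Import complex.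
From mathcomp Require Import all_classical all_reals all_analysis.
From mathcomp Require Import measurable_realfun ess_sup_inf.
From mathcomp Require Import ring lra zify.
Set Implicit Arguments.
Unset Strict Implicit.
Unset Printing Implicit Defensive.
Import Order.TTheory GRing.Theory Num.Theory.
Import numFieldNormedType.Exports.
Local Open Scope classical_set_scope.
Local Open Scope ring_scope.

(** Write w for the sup norm of the eigenfunctions, a function on the index
set I, and put mu = w^2 and b = |a| / w.  Then |a|^q w^(2 - q) = b^q mu, so
that l^1, l^2 and l^p are the Lebesgue spaces L^1, L^2 and L^p of one and the
same measure mu on I, read on b.  The weights are finite by hypothesis and
positive because biorthogonality prevents an eigenfunction from vanishing
almost everywhere ([Linfty_norm_gt0]).  What remains is the classical identity
(L^1, L^2)_(theta, p) = L^p for an atomic measure, proved here directly by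
real-variable means.

The K-functional is monotone in t, so the interpolation integral is comparable
with the sum over k in Z of 2^(- theta p k) K(2^k)^p
([integral_le_dyadic_K_sum], [dyadic_K_sum_le_integral]).  The decreasing
rearrangement of b enters only through its values at powers of 4: s_j is the
least r >= 0 with mu(b > r) <= 4^j ([levels]).  Since theta p = 2 p - 2, the
two norms are compared through the sum over j of 4^j s_j^p, as follows.

- This sum is comparable with the integral of b^p: one direction cuts I into
  the shells s_(j+1) < b <= s_j ([wsum_le_level_sum]), the other is a dyadic
  layer-cake argument ([level_sum_le_wsum]).

- For any decomposition a = a0 + a1, Chebyshev's inequality applied to b0 and
  b1 gives s_j <= 4 4^(-j) K(2^j) ([level_le_decomposition]); this bounds the
  l^p norm by the interpolation norm.

- Conversely K(2^k) is tested on the decomposition of a at height s_k.  Each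
  piece is summed over shells, with the shells j < k for the part above s_k
  and the shells j >= k for the part below; the discrete Hardy inequalities
  [hardy_down] and [hardy_up] then bound the sum over k of the p-th powers by
  the sum of 4^j s_j^p ([high_part_le], [low_part_le]).  They converge because
  1 < p < 2. *)

(** * Sums of nonnegative extended reals *)

Local Notation "'\total_' ( i : T ) F" := (\esum_(i in [set: T]) F%E)
  (at level 41, i at level 50, F at level 41,
   format "'[' \total_ ( i  :  T ) '/  '  F ']'").

Section nonneg_sums.
Local Open Scope ereal_scope.
Context {R : realType}.

Lemma le_total_term (T : choiceType) (a : T -> \bar R) (t : T) :
  (forall i, 0 <= a i) -> a t <= \total_(i : T) a i.
Proof.
move=> a0; rewrite -(esum_set1 (a0 t)) esum_mkcond.
by apply: le_esum => i _; case: ifP.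
Qed.

Lemma total_ge0 (T : choiceType) (a : T -> \bar R) :
  (forall i, 0 <= a i) -> 0 <= \total_(i : T) a i.
Proof. by move=> a0; apply: esum_ge0. Qed.

Lemma totalZr_le (T : choiceType) (a : T -> \bar R) (c : \bar R) :
  (forall i, 0 <= a i) -> 0 <= c ->
  \total_(i : T) (a i * c) <= (\total_(i : T) a i) * c.
Proof.
move=> a0 c0; apply: ge_ereal_sup => _ [F [finF _]] <-.
rewrite fsbig_finite//= -ge0_sume_distrl//; apply: lee_wpmul2r => //.
by apply: esum_ge; exists F => //; rewrite fsbig_finite.
Qed.

Lemma totalZl (T : choiceType) (a : T -> \bar R) (c : R) :
  (forall i, 0 <= a i) -> (0 <= c)%R ->
  \total_(i : T) (c%:E * a i) = c%:E * \total_(i : T) a i.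
Proof.
move=> a0; rewrite le_eqVlt => /predU1P[<-|c0].
  by rewrite mul0e esum1// => i _; rewrite mul0e.
apply/eqP; rewrite eq_le; apply/andP; split.
  by under eq_esum do rewrite muleC; rewrite muleC totalZr_le ?lee_fin ?ltW.
have ci : (0 <= c^-1)%R by rewrite invr_ge0 ltW.
rewrite -lee_pdivlMl// muleC.
have aE i : a i = c%:E * a i * c^-1%:E.
  by rewrite muleAC -EFinM divff ?gt_eqF ?mul1e.
under eq_esum do rewrite aE.
by apply: totalZr_le => [i|]; rewrite ?mule_ge0 ?lee_fin// ltW.
Qed.

Lemma total_exchange (T T' : choiceType) (a : T -> T' -> \bar R) :
  (forall i j, 0 <= a i j) ->
  \total_(i : T) \total_(j : T') a i j = \total_(j : T') \total_(i : T) a i j.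
Proof.
move=> a0; rewrite !esum_esum//.
rewrite (reindex_esum ([set: T'] `*`` fun=> [set: T]) _ (fun x => (x.2, x.1)))//.
split => //= [[i j] [i' j'] _ _ [-> ->]//|[i j] _].
by exists (j, i).
Qed.

Lemma total_bij (T T' : choiceType) (e : T -> T') (a : T' -> \bar R) :
  bijective e -> \total_(i : T') a i = \total_(i : T) a (e i).
Proof.
move=> [f ef fe]; apply: reindex_esum; split => // [x y _ _ /(congr1 f)|y _].
  by rewrite !ef.
by exists (f y) => //; rewrite fe.
Qed.

Lemma lee_poweR (x y : \bar R) (q : R) : (0 <= q)%R -> 0 <= x -> x <= y ->
  x `^ q <= y `^ q.
Proof.
move=> q0 x0 xy; apply: gt0_ler_poweR => //; rewrite in_itv/= leey andbT//.
exact: le_trans xy.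
Qed.

Lemma lee_poweR_root (x y : \bar R) (q : R) : (0 < q)%R -> 0 <= x ->
  x `^ q <= y -> x <= y `^ q^-1.
Proof.
move=> q0 x0 xy; rewrite -[leLHS]poweRe1// -(@divff _ q) ?gt_eqF// poweRrM.
by apply: lee_poweR => //; [rewrite invr_ge0 ltW|exact: poweR_ge0].
Qed.

End nonneg_sums.

(** * Powers of two with real exponents *)

Section powers_of_two.
Context {R : realType}.
Implicit Types x y q : R.

Definition pow2 x : R := 2 `^ x.

Lemma pow2_gt0 x : 0 < pow2 x. Proof. exact: powR_gt0. Qed.
Lemma pow2_ge0 x : 0 <= pow2 x. Proof. exact: powR_ge0. Qed.
Lemma pow2_0 : pow2 0 = 1. Proof. exact: powRr0. Qed.
Lemma pow2_1 : pow2 1 = 2. Proof. exact: powRr1. Qed.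

Lemma pow2D x y : pow2 (x + y) = pow2 x * pow2 y.
Proof. by rewrite /pow2 powRD// pnatr_eq0 implybT. Qed.

Lemma pow2N x : pow2 (- x) = (pow2 x)^-1.
Proof. exact: powRN. Qed.

Lemma pow2M x q : pow2 x `^ q = pow2 (x * q).
Proof. by rewrite /pow2 powRrM. Qed.

Lemma ler_pow2 x y : (pow2 x <= pow2 y) = (x <= y).
Proof.
have ln2 : 0 < ln (2 : R) by apply: ln_gt0; rewrite ltr1n.
by rewrite /pow2 /powR pnatr_eq0/= ler_expR ler_pM2r.
Qed.

Lemma ltr_pow2 x y : (pow2 x < pow2 y) = (x < y).
Proof. by rewrite !ltNge ler_pow2. Qed.

Lemma pow2_bracket x (al : R) : 0 < al -> 0 < x ->
  exists l : int, pow2 (al * l%:~R) < x <= pow2 (al * (l + 1)%:~R).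
Proof.
move=> al0 x0; pose y : R := ln x / ln 2 / al.
have ln2 : 0 < ln (2 : R) by apply: ln_gt0; rewrite ltr1n.
have xE : x = pow2 (al * y).
  rewrite /y mulrC divfK ?gt_eqF// /pow2 /powR pnatr_eq0/= divfK ?gt_eqF//.
  by rewrite lnK.
exists (Num.ceil y - 1); rewrite xE ltr_pow2 ler_pow2 subrK.
by rewrite ltr_pM2l// ler_pM2l// ceil_itv.
Qed.
End powers_of_two.

(** * Dyadic sums and discrete Hardy inequalities *)

Section dyadic_sums.
Local Open Scope ereal_scope.
Context {R : realType}.

Lemma total_geometric (de : R) : (0 < de)%R -> exists2 C : R, (0 < C)%R &
  \total_(i : nat) (pow2 (- (de * i%:R)))%:E <= C%:E.
Proof.
move=> de0; set x := pow2 (- de)%R.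
have x0 : (0 < x)%R by exact: pow2_gt0.
have x1 : (x < 1)%R by rewrite -pow2_0 ltr_pow2 oppr_lt0.
have xE i : pow2 (- (de * i%:R)) = (x ^+ i)%R.
  by rewrite -powR_mulrn ?ltW// pow2M mulNr.
exists (1 - x)^-1%R; first by rewrite invr_gt0 subr_gt0.
rewrite -nneseries_esumT; last by move=> i; rewrite lee_fin pow2_ge0.
apply: lime_le; first by apply: is_cvg_nneseries => i _ _; rewrite lee_fin pow2_ge0.
apply: nearW => n; rewrite sumEFin lee_fin; under eq_bigr do rewrite xE.
have := @geometric_le_lim R n 1 x ler01 x0; rewrite gtr0_norm// mul1r.
move=> /(_ x1); rewrite /series/=; congr (_ <= _)%R.
by apply: eq_bigr => i _; rewrite mul1r.
Qed.

(** This replaces Hoelder's inequality for q >= 1 and subadditivity of the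
power for q <= 1: if N is the sum on the right, every term satisfies
y_i <= 2^(- de i / q) N^(1/q), and these bounds form a geometric series. *)
Lemma poweR_total_le (q de : R) : (0 < q)%R -> (0 < de)%R ->
  exists2 C : R, (0 < C)%R & forall y : nat -> \bar R, (forall i, 0 <= y i) ->
    (\total_(i : nat) y i) `^ q <=
    C%:E * \total_(i : nat) ((pow2 (de * i%:R))%:E * y i `^ q).
Proof.
move=> q0 de0.
have [C C0 HC] := @total_geometric (de / q) (divr_gt0 de0 q0).
exists (C `^ q)%R; first exact: powR_gt0.
move=> y y0.
set N := \total_(i : nat) ((pow2 (de * i%:R))%:E * y i `^ q).
have t0 i : 0 <= (pow2 (de * i%:R))%:E * y i `^ q.
  by rewrite mule_ge0 ?poweR_ge0// lee_fin pow2_ge0.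
have N0 : 0 <= N by exact: total_ge0.
have yN i : y i <= (pow2 (- (de / q * i%:R)))%:E * N `^ q^-1.
  have : y i `^ q <= (pow2 (- (de * i%:R)))%:E * N.
    rewrite pow2N lee_pdivlMl ?pow2_gt0//.
    exact: (le_total_term i t0).
  move=> /(lee_poweR_root q0 (y0 i)) /le_trans; apply.
  rewrite poweRM ?lee_fin ?pow2_ge0// poweR_EFin pow2M.
  by rewrite mulNr mulrAC.
have : \total_(i : nat) y i <= C%:E * N `^ q^-1.
  apply: le_trans (_ : \total_(i : nat)
    ((pow2 (- (de / q * i%:R)))%:E * N `^ q^-1) <= _); first exact: le_esum.
  apply: le_trans (totalZr_le _ _) _; rewrite ?poweR_ge0//.
    by move=> i; rewrite lee_fin pow2_ge0.
  by apply: lee_wpmul2r => //; rewrite poweR_ge0.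
move=> /(lee_poweR (ltW q0) (total_ge0 y0)) /le_trans; apply.
rewrite poweRM ?lee_fin ?poweR_ge0 ?(ltW C0)// poweR_EFin -poweRrM mulVf ?gt_eqF//.
by rewrite poweRe1.
Qed.

(** With the geometric loss 2^(al i / 2) granted by [poweR_total_le], exchanging
the sums and putting j = k + i leaves 2^(al (j - i)) 2^(al i / 2), which is
summable in i. *)
Lemma hardy_up (al q : R) : (0 < al)%R -> (0 < q)%R ->
  exists2 C : R, (0 < C)%R & forall z : int -> \bar R, (forall j, 0 <= z j) ->
    \total_(k : int) ((pow2 (al * k%:~R))%:E *
                      (\total_(i : nat) z (k + i%:Z)%R) `^ q) <=
    C%:E * \total_(j : int) ((pow2 (al * j%:~R))%:E * z j `^ q).
Proof.
move=> al0 q0; have d0 : (0 < al / 2)%R by rewrite divr_gt0.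
have [C C0 HC] := poweR_total_le q0 d0; have [D D0 HD] := total_geometric d0.
exists (C * D)%R; first exact: mulr_gt0.
move=> z z0.
have p0 x : 0 <= (pow2 x)%:E :> \bar R by rewrite lee_fin pow2_ge0.
have t0 j : 0 <= (pow2 (al * j%:~R))%:E * z j `^ q.
  by rewrite mule_ge0 ?poweR_ge0.
apply: (@le_trans _ _ (\total_(k : int) (C%:E * \total_(i : nat)
    ((pow2 (al * k%:~R))%:E * ((pow2 (al / 2 * i%:R))%:E * z (k + i%:Z)%R `^ q))))).
  apply: le_esum => k _; rewrite totalZl ?pow2_ge0//; last first.
    by move=> i; rewrite mule_ge0 ?poweR_ge0.
  rewrite muleCA; apply: lee_wpmul2l => //; exact: HC.
rewrite totalZl ?(ltW C0)//; last first.
  by move=> k; apply: total_ge0 => i; rewrite !mule_ge0 ?poweR_ge0.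
rewrite EFinM -muleA; apply: lee_wpmul2l; first by rewrite lee_fin ltW.
rewrite total_exchange; last by move=> k i; rewrite !mule_ge0 ?poweR_ge0.
apply: (@le_trans _ _ (\total_(i : nat) ((pow2 (- (al / 2 * i%:R)))%:E *
    \total_(j : int) ((pow2 (al * j%:~R))%:E * z j `^ q)))).
  apply: le_esum => i _.
  rewrite (@total_bij _ _ _ (fun k : int => k - i%:Z)%R); last first.
    by exists (fun k : int => k + i%:Z)%R => k; rewrite ?subrK ?addrK.
  rewrite -totalZl ?pow2_ge0//; apply: le_esum => j _.
  rewrite subrK !muleA; apply: lee_wpmul2r; first exact: poweR_ge0.
  rewrite -!EFinM -!pow2D lee_fin ler_pow2 rmorphB/= -pmulrn; lra.
apply: le_trans (totalZr_le _ _) _ => //; first exact: total_ge0.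
by apply: lee_wpmul2r => //; exact: total_ge0.
Qed.

Lemma hardy_down (al q : R) : (0 < al)%R -> (0 < q)%R ->
  exists2 C : R, (0 < C)%R & forall z : int -> \bar R, (forall j, 0 <= z j) ->
    \total_(k : int) ((pow2 (- (al * k%:~R)))%:E *
                      (\total_(i : nat) z (k - i%:Z)%R) `^ q) <=
    C%:E * \total_(j : int) ((pow2 (- (al * j%:~R)))%:E * z j `^ q).
Proof.
move=> al0 q0; have [C C0 HC] := hardy_up al0 q0; exists C => // z z0.
have bij_opp : bijective (-%R : int -> int) by exists -%R => k; rewrite opprK.
rewrite (total_bij _ bij_opp) [in leRHS](total_bij _ bij_opp).
have := HC (z \o -%R) (fun j => z0 (- j)%R).
congr (_ <= _); last congr (_ * _); apply: eq_esum => k _ /=;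
  rewrite rmorphN/= mulrN opprK//.
by congr (_ * _ `^ _); apply: eq_esum => i _; rewrite opprD.
Qed.

(** The powers of two below x form a geometric series dominated by its largest
term.  With [total_pow2_ge] this is a layer-cake formula for x, up to
constants. *)
Lemma total_pow2_lt (al : R) : (0 < al)%R -> exists2 C : R, (0 < C)%R &
  forall x : \bar R, 0 <= x ->
  \total_(l : int) (pow2 (al * l%:~R) * ((pow2 (al * l%:~R))%:E < x)%E%:R)%:E
    <= C%:E * x.
Proof.
move=> al0; have [C C0 HC] := total_geometric al0; exists C => // -[r||]//; last first.
  by move=> _; rewrite gt0_muley ?lte_fin// leey.
rewrite lee_fin le_eqVlt => /predU1P[<-|r0].
  rewrite mule0 esum1// => l _.
  by rewrite lte_fin ltNge pow2_ge0 mulr0.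
have [l0 /andP[l0r rl0]] := pow2_bracket al0 r0.
rewrite (@le_trans _ _ (\esum_(l in [set l | l <= l0]%R)
    (pow2 (al * l%:~R))%:E))//.
  rewrite [leRHS]esum_mkcond; apply: le_esum => l _; rewrite lte_fin.
  case: ltP => lr; rewrite ?mulr1 ?mulr0; last first.
    by case: ifP => // _; rewrite lee_fin pow2_ge0.
  rewrite mem_set//=.
  have := lt_le_trans lr rl0; rewrite ltr_pow2 ltr_pM2l// ltr_int.
  by rewrite ltzD1.
rewrite (reindex_esum [set: nat] _ (fun i : nat => l0 - i%:Z)%R)//; last first.
  split => [i _/=|i j _ _ /addrI/oppr_inj[]//|l/= ll0].
    by rewrite gerBl.
  exists `|l0 - l|%N => //; rewrite gez0_abs ?subr_ge0//; lia.
rewrite (@le_trans _ _ (\total_(i : nat) ((pow2 (- (al * i%:R)))%:E * r%:E)))//.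
  apply: le_esum => i _; rewrite -EFinM lee_fin rmorphB/= mulrBr addrC pow2D.
  by rewrite ler_wpM2l ?pow2_ge0// ltW.
apply: le_trans (totalZr_le _ _) _; rewrite ?lee_fin ?(ltW r0)//.
  by move=> i; rewrite lee_fin pow2_ge0.
by apply: lee_wpmul2r => //; rewrite lee_fin ltW.
Qed.

Lemma total_pow2_ge (al : R) (x : R) : (0 < al)%R -> (0 <= x)%R ->
  x%:E <= (pow2 al)%:E *
  \total_(l : int) (pow2 (al * l%:~R) * (pow2 (al * l%:~R) < x)%R%:R)%:E.
Proof.
move=> al0; have t0 (l : int) :
    0 <= (pow2 (al * l%:~R) * (pow2 (al * l%:~R) < x)%R%:R)%:E.
  by rewrite lee_fin mulr_ge0 ?pow2_ge0.
rewrite le_eqVlt => /predU1P[x0|x0].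
  by rewrite -{1}x0 mule_ge0 ?lee_fin ?pow2_ge0//; exact: total_ge0.
have [l /andP[lx xl]] := pow2_bracket al0 x0.
rewrite (@le_trans _ _ ((pow2 al)%:E * (pow2 (al * l%:~R))%:E))//.
  by rewrite -EFinM lee_fin -pow2D -[X in pow2 (X + _)]mulr1 -mulrDr addrC -intrD1.
apply: lee_wpmul2l; first by rewrite lee_fin pow2_ge0.
by apply: le_trans (le_total_term l t0); rewrite lx mulr1.
Qed.

End dyadic_sums.

(** * Level sets and the decreasing rearrangement at powers of 4 *)

Section level_sets.
Local Open Scope ereal_scope.
Context {R : realType} {I : choiceType} (mu b : I -> R).
Hypotheses (mu_gt0 : forall i, (0 < mu i)%R) (b_ge0 : forall i, (0 <= b i)%R).

Definition tail_mass (r : R) : \bar R :=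
  \total_(i : I) (mu i * (r < b i)%R%:R)%:E.

Definition wsum (q : R) : \bar R := \total_(i : I) (mu i * b i `^ q)%:E.

Lemma wterm_ge0 x i : (0 <= x)%R -> 0 <= (mu i * x)%:E.
Proof. by move=> x0; rewrite lee_fin mulr_ge0// ltW. Qed.
#[local] Hint Resolve wterm_ge0 : core.

Lemma tail_mass_ge0 r : 0 <= tail_mass r.
Proof. by apply: total_ge0 => i; rewrite wterm_ge0. Qed.

Lemma le_tail_mass r i : (r < b i)%R -> (mu i)%:E <= tail_mass r.
Proof.
move=> rb; apply: le_trans (le_total_term i _).
  by rewrite rb mulr1.
by move=> j; rewrite wterm_ge0.
Qed.

(** The number s_j is the decreasing rearrangement of b evaluated at 4^j: the
infimum of the r >= 0 with tail mass at most 4^j, which is attained. *)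
Record levels (s : int -> R) : Prop := Levels {
  level_ge0 : forall j, (0 <= s j)%R;
  tail_mass_level : forall j,
    tail_mass (s j) <= (pow2 (2 * j%:~R))%:E;
  below_level : forall j r, (0 <= r)%R -> (r < s j)%R ->
    (pow2 (2 * j%:~R))%:E < tail_mass r }.

(** A decay of the tail mass like that of a sum of an L^1 and an L^2 function
makes the infima finite; they are attained because the tail mass is a supremum
over finite sets, and a finite set of indices above the infimum already lies
above some admissible r. *)
Lemma levels_exist (A B : R) : (0 <= A)%R -> (0 <= B)%R ->
  (forall r, (0 < r)%R -> tail_mass r <= (A / r + B / r ^+ 2)%:E) ->
  exists s, levels s.
Proof.
move=> A0 B0 dAB.
pose S j := [set r : R | (0 <= r)%R /\ tail_mass r <= (pow2 (2 * j%:~R))%:E].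
have S0 j : S j !=set0.
  have c0 := @pow2_gt0 R (2 * j%:~R); set c := pow2 _ in c0 *.
  have AB0 : (0 <= (A + B) / c)%R by rewrite divr_ge0 ?addr_ge0// ltW.
  exists (1 + (A + B) / c)%R; split; first by rewrite addr_ge0.
  apply: le_trans (dAB _ _) _; first by rewrite ltr_pwDl.
  set r := (1 + _)%R; have r1 : (1 <= r)%R by rewrite lerDl.
  have r0 : (0 < r)%R by exact: lt_le_trans r1.
  rewrite lee_fin; apply: (@le_trans _ _ ((A + B) / r)%R).
    rewrite mulrDl lerD2l ler_wpM2l// lef_pV2 ?posrE ?exprn_gt0//.
    by rewrite expr2 ler_peMr// ltW.
  rewrite ler_pdivrMr// mulrDr mulr1 mulrCA divff ?mulr1 ?gt_eqF//.
  by rewrite lerDr ltW.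
have Slb j : has_inf (S j) by split => //; exists 0%R => r [].
exists (fun j => inf (S j)); split => [j|j|j r r0 rs].
- by apply: lb_le_inf => // r [].
- apply: ge_ereal_sup => _ [F [finF _]] <-; rewrite fsbig_finite//=.
  (* One admissible r serves all indices of F above the infimum at once. *)
  have [r [r0 dr] rb] : exists2 r, S j r & 
      forall i, i \in finmap.enum_fset (fset_set F) ->
      (inf (S j) < b i)%R -> (r < b i)%R.
    elim: (finmap.enum_fset (fset_set F)) => [|i X [r Sr rX]].
      by have [r Sr] := S0 j; exists r.
    have [ib|ib] := ltP (inf (S j)) (b i); last first.
      by exists r => // k; rewrite inE => /predU1P[->|/rX//]; rewrite ltNge ib.
    have e0 : (0 < b i - inf (S j))%R by rewrite subr_gt0.
    have [r' Sr' r'b] := inf_adherent e0 (Slb j).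
    rewrite addrC subrK in r'b.
    exists (Num.min r r'); first by case: (leP r r').
    move=> k; rewrite inE => /predU1P[->|kX] kb; first by rewrite gt_min r'b orbT.
    by rewrite gt_min rX.
  apply: le_trans dr; apply: esum_ge; exists F => //; rewrite fsbig_finite//=.
  rewrite big_seq [leRHS]big_seq; apply: lee_sum => i iF.
  rewrite lee_fin ler_wpM2l ?(ltW (mu_gt0 i))//.
  by case: ltP => // /(rb _ iF) ->.
- rewrite ltNge; apply/negP => dr.
  by have : (inf (S j) <= r)%R; [apply: ge_inf => //; exact: (Slb j).2|rewrite leNgt rs].
Qed.

Section given_levels.
Hypothesis tail_mass_fin : forall r, (0 < r)%R -> tail_mass r < +oo.
Variables (s : int -> R) (s_levels : levels s).

Lemma levels_nonincreasing j : (s (j + 1) <= s j)%R.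
Proof.
rewrite leNgt; apply/negP => /(below_level s_levels (level_ge0 s_levels j)).
rewrite ltNge (le_trans (tail_mass_level s_levels j))// lee_fin ler_pow2.
by rewrite ler_pM2l// ler_int lerDl.
Qed.

(** The levels below s_k tend to 0, because the tail mass at b_i / 2 is finite
and so at most 4^j for large j; the first level below b_i gives the shell. *)
Lemma level_below k i : (0 < b i)%R -> (b i <= s k)%R ->
  exists n : nat, (s (k + n%:Z + 1) < b i <= s (k + n%:Z))%R.
Proof.
move=> b0 bs.
have ex : exists n : nat, (s (k + n%:Z) < b i)%R.
  have r0 : (0 < b i / 2)%R by rewrite divr_gt0.
  have : tail_mass (b i / 2) \is a fin_num.
    by rewrite ge0_fin_numE ?tail_mass_fin ?tail_mass_ge0.
  move=> /fineK; set D := fine _ => DE.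
  have D1 : (0 < Num.max D 1)%R by rewrite lt_max ltr01 orbT.
  have [l /andP[_ Dl]] := @pow2_bracket R _ 2 (ltr0n _ 2) D1.
  exists (absz (l + 1 - k)%R); rewrite ltNge; apply/negP => bl.
  have : (b i / 2 < s (k + (absz (l + 1 - k)%R)))%R.
    by apply: lt_le_trans bl; rewrite ltr_pdivrMr// ltr_pMr// ltr1n.
  move=> /(below_level s_levels (ltW r0)); rewrite -DE lte_fin ltNge.
  rewrite (@le_trans _ _ (Num.max D 1%R))//; first by rewrite le_max lexx.
  apply: le_trans Dl _; rewrite ler_pow2 ler_pM2l// ler_int; lia.
have [[|n] nb minn] := ex_minnP ex.
  by move: nb; rewrite addr0 ltNge bs.
exists n; rewrite -addrA -PoszD addn1 nb/= leNgt.
by apply/negP => /minn; rewrite ltnn.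
Qed.

(** An atom of mass more than 4^j cannot lie above s_j. *)
Lemma level_above_exists i : exists j, (b i <= s j)%R.
Proof.
have [l /andP[lm _]] := @pow2_bracket R _ 2 (ltr0n _ 2) (mu_gt0 i).
exists l; rewrite leNgt; apply/negP => /le_tail_mass.
by rewrite leNgt (le_lt_trans (tail_mass_level s_levels l)).
Qed.

Lemma level_above k i : (s k < b i)%R ->
  exists n : nat, (s (k - n%:Z) < b i <= s (k - n%:Z - 1))%R.
Proof.
move=> sb.
have homo (j : int) (n : nat) : (s (j + n%:Z) <= s j)%R.
  elim: n => [|n]; first by rewrite addr0.
  by apply: le_trans; rewrite -addn1 PoszD addrA levels_nonincreasing.
have ex : exists n : nat, (b i <= s (k - n%:Z))%R.
  have [j bj] := level_above_exists i; exists `|k - j|%N.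
  have [kj|jk] := leP k j.
    suff : (s j <= s k)%R by rewrite leNgt (lt_le_trans sb).
    have -> : j = (k + `|j - k|%N%:Z)%R by lia.
    exact: homo.
  apply: (le_trans bj).
  by have -> : (k - `|k - j|%N%:Z)%R = j by lia.
have [[|n] nb minn] := ex_minnP ex.
  by move: nb; rewrite subr0 leNgt sb.
exists n; rewrite -addrA -opprD -PoszD addn1 nb andbT ltNge.
by apply/negP => /minn; rewrite ltnn.
Qed.

(** On the shell s_(j+1) < b <= s_j the integrand is at most s_j^q, and the
shell has mass at most mu(b > s_(j+1)) <= 4^(j+1). *)
Lemma wsum_shells (J : choiceType) (e : J -> int) (P : pred I) (q : R) :
  (0 < q)%R ->
  (forall i, P i -> (0 < b i)%R ->
     exists n, (s (e n + 1) < b i <= s (e n))%R) ->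
  \total_(i : I) (mu i * (b i `^ q * (P i)%:R))%:E <=
  \total_(n : J) (pow2 (2 * (e n + 1)%:~R) * s (e n) `^ q)%:E.
Proof.
move=> q0 shell.
have t0 n i : (0 <= s (e n) `^ q * (mu i * (s (e n + 1) < b i)%R%:R))%R.
  by rewrite mulr_ge0 ?powR_ge0// mulr_ge0// ltW.
apply: (@le_trans _ _ (\total_(i : I) \total_(n : J)
    (s (e n) `^ q * (mu i * (s (e n + 1) < b i)%R%:R))%:E)).
  apply: le_esum => i _; have := b_ge0 i; rewrite le_eqVlt => /predU1P[b0|b0].
    rewrite -{1}b0 powR0 ?gt_eqF// mul0r mulr0; apply: total_ge0 => n.
    by rewrite lee_fin t0.
  have [Pi|_] := boolP (P i); last first.
    by rewrite !mulr0; apply: total_ge0 => n; rewrite lee_fin t0.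
  have [n /andP[sb bs]] := shell i Pi b0.
  apply: le_trans (le_total_term n _); last by move=> k; rewrite lee_fin t0.
  rewrite sb !mulr1 lee_fin mulrC ler_wpM2r ?(ltW (mu_gt0 i))//.
  by rewrite ge0_ler_powR ?nnegrE ?(ltW q0)// (level_ge0 s_levels).
rewrite total_exchange; last by move=> i n; rewrite lee_fin t0.
apply: le_esum => n _; under eq_esum do rewrite EFinM.
rewrite totalZl ?powR_ge0//; last by move=> i; rewrite wterm_ge0.
rewrite EFinM muleC; apply: lee_wpmul2r; first by rewrite lee_fin powR_ge0.
exact: (tail_mass_level s_levels).
Qed.

End given_levels.
End level_sets.

(** * The sum of 4^j s_j^q against the integral of b^q *)

Section level_sums.
Local Open Scope ereal_scope.
Context {R : realType} {I : choiceType}.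
Implicit Types (mu b : I -> R) (s : int -> R).

Definition level_sum s (q : R) : \bar R :=
  \total_(j : int) (pow2 (2 * j%:~R) * s j `^ q)%:E.

Lemma wsum_ge0 mu b q : (forall i, 0 < mu i)%R -> 0 <= wsum mu b q.
Proof. by move=> mu0; apply: total_ge0 => i; exact/wterm_ge0/powR_ge0. Qed.

Lemma wsum_le_level_sum mu b s (q : R) :
  (forall i, 0 < mu i)%R -> (forall i, 0 <= b i)%R ->
  (forall r, (0 < r)%R -> tail_mass mu b r < +oo) -> levels mu b s ->
  (0 < q)%R -> wsum mu b q <= (pow2 2)%:E * level_sum s q.
Proof.
move=> mu0 b0 dfin sl q0.
have shell i : xpredT i -> (0 < b i)%R ->
    exists j : int, (s (id j + 1) < b i <= s (id j))%R.
  move=> _ bi; have [j bj] := level_above_exists mu0 sl i.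
  have [n sn] := level_below mu0 dfin sl bi bj.
  by exists (j + n%:Z)%R.
have := wsum_shells mu0 b0 sl q0 shell.
rewrite -totalZl ?pow2_ge0//; last first.
  by move=> j; rewrite lee_fin mulr_ge0 ?pow2_ge0 ?powR_ge0.
congr (_ <= _); first by apply: eq_esum => i _; rewrite /= mulr1.
apply: eq_esum => j _; rewrite -EFinM mulrA -pow2D intrD1 mulrDr mulr1 addrC //.
Qed.

(** Up to a constant, s_j^q is the sum of the 2^(q l) with 2^l < s_j.  For such
l one has 4^j < mu(b > 2^l), so summing over j first gives a geometric series
dominated by mu(b > 2^l); the sum over l of 2^(q l) mu(b > 2^l) is again a
layer-cake sum for the integral of b^q. *)
Lemma level_sum_le_wsum (q : R) : (0 < q)%R -> exists2 C : R, (0 < C)%R &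
  forall mu b s, (forall i, 0 < mu i)%R -> (forall i, 0 <= b i)%R ->
  levels mu b s -> level_sum s q <= C%:E * wsum mu b q.
Proof.
move=> q0; have [C C0 HC] := @total_pow2_lt R 2 (ltr0n _ 2).
have [D D0 HD] := total_pow2_lt q0.
exists (pow2 q * (C * D))%R; first by rewrite !mulr_gt0 ?pow2_gt0.
move=> mu b s mu0 b0 sl.
have pltE (l : int) x : (0 <= x)%R ->
    (pow2 (q * l%:~R) < x `^ q)%R = (pow2 l%:~R < x)%R.
  move=> x0; rewrite mulrC -pow2M; apply/idP/idP; last first.
    by move=> lx; rewrite gt0_ltr_powR ?nnegrE ?pow2_ge0.
  rewrite !ltNge; apply: contra => lx.
  by rewrite ge0_ler_powR ?nnegrE ?pow2_ge0 ?(ltW q0).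
have t0 (j l : int) : (0 <= pow2 (2 * j%:~R) *
    (pow2 (q * l%:~R) * (pow2 l%:~R < s j)%R%:R))%R.
  by rewrite !mulr_ge0 ?pow2_ge0.
apply: (@le_trans _ _ ((pow2 q)%:E * \total_(j : int) \total_(l : int)
   (pow2 (2 * j%:~R) * (pow2 (q * l%:~R) * (pow2 l%:~R < s j)%R%:R))%:E)).
  rewrite -totalZl ?pow2_ge0//; last first.
    by move=> j; apply: total_ge0 => l; rewrite lee_fin t0.
  apply: le_esum => j _; under eq_esum do rewrite EFinM.
  rewrite totalZl ?pow2_ge0//; last first.
    by move=> l; rewrite lee_fin mulr_ge0 ?pow2_ge0.
  rewrite muleCA EFinM; apply: lee_wpmul2l; first by rewrite lee_fin pow2_ge0.
  under eq_esum do rewrite -pltE ?(level_ge0 sl)//.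
  by apply: total_pow2_ge => //; rewrite powR_ge0.
rewrite EFinM -muleA; apply: lee_wpmul2l; first by rewrite lee_fin pow2_ge0.
rewrite total_exchange; last by move=> j l; rewrite lee_fin t0.
have u0 (l : int) i :
    (0 <= pow2 (q * l%:~R) * (mu i * (pow2 l%:~R < b i)%R%:R))%R.
  by rewrite !mulr_ge0 ?pow2_ge0// ltW.
apply: (@le_trans _ _ (C%:E * \total_(l : int) \total_(i : I)
   (pow2 (q * l%:~R) * (mu i * (pow2 l%:~R < b i)%R%:R))%:E)).
  rewrite -totalZl ?(ltW C0)//; last first.
    by move=> l; apply: total_ge0 => i; rewrite lee_fin u0.
  apply: le_esum => l _.
  under [in leRHS]eq_esum do rewrite EFinM.
  rewrite totalZl ?pow2_ge0//; last by move=> i; exact: wterm_ge0.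
  rewrite -/(tail_mass mu b (pow2 l%:~R)) muleCA.
  apply: le_trans (lee_wpmul2l _ (HC _ (tail_mass_ge0 _ mu0 _))); last first.
    by rewrite lee_fin pow2_ge0.
  rewrite -totalZl ?pow2_ge0//; last first.
    by move=> j; rewrite lee_fin mulr_ge0 ?pow2_ge0.
  apply: le_esum => j _; rewrite -EFinM lee_fin mulrCA.
  rewrite ler_wpM2l ?pow2_ge0// ler_wpM2l ?pow2_ge0//.
  case: ltP => //= ls; first by rewrite (below_level sl) ?pow2_ge0.
rewrite EFinM -muleA; apply: lee_wpmul2l; first by rewrite lee_fin ltW.
rewrite total_exchange; last by move=> l i; rewrite lee_fin u0.
rewrite /wsum -totalZl ?(ltW D0)//; last by move=> i; exact/wterm_ge0/powR_ge0.
apply: le_esum => i _; under eq_esum do rewrite mulrCA EFinM.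
rewrite totalZl ?(ltW (mu0 i))//; last first.
  by move=> l; rewrite lee_fin mulr_ge0 ?pow2_ge0.
rewrite EFinM muleCA; apply: lee_wpmul2l; first by rewrite lee_fin ltW.
have := HD (b i `^ q)%:E; rewrite lee_fin => /(_ (powR_ge0 _ _)).
by congr (_ <= _); apply: eq_esum => l _; rewrite lte_fin pltE.
Qed.

(** Here z_j = 4^j s_(j-1) bounds the integral of b over the shell between
s_j and s_(j-1), and 2^(- (2 p - 2) j) z_j^p = 4^j s_(j-1)^p. *)
Lemma high_part_le (p : R) : (1 < p)%R -> exists2 C : R, (0 < C)%R &
  forall mu b s, (forall i, 0 < mu i)%R -> (forall i, 0 <= b i)%R ->
  levels mu b s ->
  \total_(k : int) ((pow2 (- ((2 * p - 2) * k%:~R)))%:E *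
    (\total_(i : I) (mu i * (b i `^ 1 * (s k < b i)%R%:R))%:E) `^ p) <=
  C%:E * level_sum s p.
Proof.
move=> p1; have p0 : (0 < p)%R by lra.
have al0 : (0 < 2 * p - 2)%R by lra.
have [C C0 HC] := hardy_down al0 p0.
exists (C * pow2 2)%R; first by rewrite mulr_gt0 ?pow2_gt0.
move=> mu b s mu0 b0 sl.
pose z (j : int) := (pow2 (2 * j%:~R) * s (j - 1) `^ 1)%R%:E.
have z0 j : 0 <= z j by rewrite lee_fin mulr_ge0 ?pow2_ge0 ?powR_ge0.
apply: (@le_trans _ _ (\total_(k : int) ((pow2 (- ((2 * p - 2) * k%:~R)))%:E *
    (\total_(n : nat) z (k - n%:Z)%R) `^ p))).
  apply: le_esum => k _; apply: lee_wpmul2l; first by rewrite lee_fin pow2_ge0.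
  apply: lee_poweR; first exact: ltW.
    by apply: total_ge0 => i; rewrite wterm_ge0// mulr_ge0 ?powR_ge0.
  apply: le_trans (@wsum_shells _ _ mu b mu0 b0 s sl nat
    (fun n => k - n%:Z - 1)%R (fun i => s k < b i)%R 1 ltr01 _) _.
    move=> i ski _; have [n sn] := level_above mu0 sl ski.
    by exists n; rewrite subrK.
  by apply: le_esum => n _; rewrite subrK.
apply: le_trans (HC _ z0) _.
rewrite EFinM -muleA; apply: lee_wpmul2l; first by rewrite lee_fin ltW.
rewrite /level_sum -totalZl ?pow2_ge0//; last first.
  by move=> j; rewrite lee_fin mulr_ge0 ?pow2_ge0 ?powR_ge0.
rewrite (@total_bij _ _ _ (fun j : int => j + 1)%R); last first.
  by exists (fun j : int => j - 1)%R => k; rewrite ?subrK ?addrK.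
apply: le_esum => j _; rewrite /z addrK poweR_EFin -!EFinM lee_fin.
rewrite powRM ?pow2_ge0 ?powR_ge0// pow2M -powRrM mul1r !mulrA -!pow2D.
rewrite ler_wpM2r ?powR_ge0// ler_pow2 intrD1; lra.
Qed.

(** Here z_j = 4^(j+1) s_j^2 bounds the integral of b^2 over the shell between
s_(j+1) and s_j, and 2^((2 - p) j) z_j^(p/2) = 2^p 4^j s_j^p. *)
Lemma low_part_le (p : R) : (0 < p)%R -> (p < 2)%R -> exists2 C : R, (0 < C)%R &
  forall mu b s, (forall i, 0 < mu i)%R -> (forall i, 0 <= b i)%R ->
  (forall r, (0 < r)%R -> tail_mass mu b r < +oo) ->
  levels mu b s ->
  \total_(k : int) ((pow2 ((2 - p) * k%:~R))%:E *
    (\total_(i : I) (mu i * (b i `^ 2 * (b i <= s k)%R%:R))%:E) `^ (p / 2)) <=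
  C%:E * level_sum s p.
Proof.
move=> p0 p2; have al0 : (0 < 2 - p)%R by lra.
have q0 : (0 < p / 2)%R by lra.
have [C C0 HC] := hardy_up al0 q0.
exists (C * pow2 p)%R; first by rewrite mulr_gt0 ?pow2_gt0.
move=> mu b s mu0 b0 dfin sl.
pose z (j : int) := (pow2 (2 * (j + 1)%:~R) * s j `^ 2)%R%:E.
have z0 j : 0 <= z j by rewrite lee_fin mulr_ge0 ?pow2_ge0 ?powR_ge0.
apply: (@le_trans _ _ (\total_(k : int) ((pow2 ((2 - p) * k%:~R))%:E *
    (\total_(n : nat) z (k + n%:Z)%R) `^ (p / 2)))).
  apply: le_esum => k _; apply: lee_wpmul2l; first by rewrite lee_fin pow2_ge0.
  apply: lee_poweR; first exact: ltW.
    by apply: total_ge0 => i; rewrite wterm_ge0// mulr_ge0 ?powR_ge0.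
  apply: (@wsum_shells _ _ mu b mu0 b0 s sl nat
    (fun n => k + n%:Z)%R (fun i => b i <= s k)%R 2 (ltr0n _ 2)).
  by move=> i ski bi; exact: (level_below mu0 dfin sl bi ski).
apply: le_trans (HC _ z0) _.
rewrite EFinM -muleA; apply: lee_wpmul2l; first by rewrite lee_fin ltW.
rewrite /level_sum -totalZl ?pow2_ge0//; last first.
  by move=> j; rewrite lee_fin mulr_ge0 ?pow2_ge0 ?powR_ge0.
apply: le_esum => j _; rewrite /z poweR_EFin -!EFinM lee_fin.
rewrite powRM ?pow2_ge0 ?powR_ge0// pow2M -powRrM !mulrA -!pow2D.
have -> : (2 * p / 2 = p)%R by lra.
rewrite ler_wpM2r ?powR_ge0// ler_pow2 intrD1; lra.
Qed.

(** Chebyshev's inequality for b0 and b1 at height r / 2: where b > r, one of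
the two exceeds r / 2. *)
Lemma tail_mass_sum_le mu b b0 b1 (A0 A1 : R) :
  (forall i, 0 < mu i)%R -> (forall i, 0 <= b0 i)%R -> (forall i, 0 <= b1 i)%R ->
  (forall i, b i <= b0 i + b1 i)%R ->
  wsum mu b0 1 <= A0%:E -> wsum mu b1 2 <= A1%:E ->
  forall r, (0 < r)%R ->
    tail_mass mu b r <= (2 * A0 / r + 4 * A1 / r ^+ 2)%:E.
Proof.
move=> mu0 b00 b10 bb wA0 wA1 r r0.
have w0 x q i : 0 <= (mu i * x i `^ q)%:E by exact/wterm_ge0/powR_ge0.
have r2 : (0 <= 2 / r)%R by rewrite divr_ge0// ltW.
have r4 : (0 <= 4 / r ^+ 2)%R by rewrite divr_ge0// exprn_ge0// ltW.
apply: (@le_trans _ _ ((2 / r)%:E * wsum mu b0 1 + (4 / r ^+ 2)%:E * wsum mu b1 2)).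
  rewrite /wsum -!totalZl// -esumD; last 2 first.
    by move=> i _; rewrite mule_ge0.
    by move=> i _; rewrite mule_ge0.
  apply: le_esum => i _; rewrite -!EFinM -EFinD lee_fin.
  rewrite !(mulrCA _ (mu i)) -mulrDr ler_wpM2l ?(ltW (mu0 i))//.
  rewrite powRr1// powR_mulrn//.
  case: ltP => rb; last by rewrite addr_ge0// mulr_ge0// exprn_ge0.
  have [b0r|b0r] := leP r (2 * b0 i)%R.
    rewrite -[leLHS]addr0 lerD//; last by rewrite mulr_ge0// exprn_ge0.
    by rewrite mulrAC ler_pdivlMr// mul1r.
  rewrite -[leLHS]add0r lerD//; first by rewrite mulr_ge0.
  rewrite mulrAC ler_pdivlMr ?exprn_gt0// mul1r.
  have rb1 : (r <= 2 * b1 i)%R by have := bb i; lra.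
  have -> : (4 * b1 i ^+ 2 = (2 * b1 i) ^+ 2)%R by ring.
  by rewrite lerXn2r ?nnegrE ?mulr_ge0 ?(ltW r0).
rewrite EFinD; apply: leeD.
  by rewrite mulrAC [leRHS]EFinM; exact: lee_wpmul2l.
by rewrite (mulrAC 4%R) [leRHS]EFinM; exact: lee_wpmul2l.
Qed.

(** Were s_j larger than the right-hand side c, some r with c <= r < s_j would
have tail mass more than 4^j, whereas [tail_mass_sum_le] bounds it by
4^j / 2 + 4^j / 4. *)
Lemma level_le_decomposition mu b s b0 b1 j :
  (forall i, 0 < mu i)%R -> (forall i, 0 <= b0 i)%R -> (forall i, 0 <= b1 i)%R ->
  (forall i, b i <= b0 i + b1 i)%R -> levels mu b s ->
  (s j)%:E <= (4 * pow2 (- (2 * j%:~R)))%:E *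
    (wsum mu b0 1 + (pow2 j%:~R)%:E * wsum mu b1 2 `^ 2^-1).
Proof.
move=> mu0 b00 b10 bb sl.
have c0 := @pow2_gt0 R j%:~R.
have w1 := wsum_ge0 b0 1 mu0; have w2 := wsum_ge0 b1 2 mu0.
have d0 : (0 < 4 * (pow2 (- (2 * j%:~R)) : R))%R by rewrite mulr_gt0 ?pow2_gt0.
move: w1 w2; case E0: (wsum mu b0 1) => [A0||]//; last first.
  by move=> _ w2; rewrite addye ?gt0_muley ?lte_fin ?leey// gt_eqF//
    (lt_le_trans ltNy0)// mule_ge0 ?poweR_ge0// lee_fin ltW.
case E1: (wsum mu b1 2) => [A1||]//; last first.
  by move=> _ _; rewrite poweRyr// gt0_muley ?lte_fin// addey// gt0_muley ?lte_fin ?leey.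
rewrite !lee_fin => A00 A10.
rewrite powR12_sqrt// leNgt.
apply/negP => cs; set c := (4 * _ * _)%R in cs.
have sA : (0 <= Num.sqrt A1)%R by rewrite sqrtr_ge0.
have c_ge0 : (0 <= c)%R by rewrite mulr_ge0 ?(ltW d0)// addr_ge0// mulr_ge0// ltW.
(* The midpoint rather than c itself, which may vanish. *)
pose r := ((c + s j) / 2)%R.
have r0 : (0 < r)%R by rewrite /r; lra.
have rs : (r < s j)%R by rewrite /r; lra.
have := below_level sl (ltW r0) rs.
rewrite ltNge => /negP; apply.
have := @tail_mass_sum_le mu b b0 b1 A0 A1 mu0 b00 b10 bb.
rewrite E0 E1 => /(_ (lexx _) (lexx _) r r0) /le_trans; apply.
have cr : (c <= r)%R by rewrite /r; lra.
rewrite lee_fin.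
have pE : (pow2 (2 * j%:~R) = pow2 j%:~R ^+ 2 :> R)%R.
  by rewrite mulr2n mulrDl mul1r pow2D expr2.
set P := pow2 (2 * j%:~R) in pE *.
have P0 : (0 < P)%R by exact: pow2_gt0.
have cE : (c * P = 4 * (A0 + pow2 j%:~R * Num.sqrt A1))%R.
  by rewrite /c pow2N -/P; field; exact: lt0r_neq0.
have h1 : (4 * A0 <= r * P)%R.
  apply: (@le_trans _ _ (c * P)%R); last by rewrite ler_wpM2r// ltW.
  by rewrite cE ler_wpM2l// lerDl mulr_ge0// ltW.
have h2 : (16 * A1 <= r ^+ 2 * P)%R.
  have h3 : (4 * (pow2 j%:~R * Num.sqrt A1) <= r * P)%R.
    apply: (@le_trans _ _ (c * P)%R); last by rewrite ler_wpM2r// ltW.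
    by rewrite cE ler_wpM2l// lerDr.
  have : ((4 * (pow2 j%:~R * Num.sqrt A1)) ^+ 2 <= (r * P) ^+ 2)%R.
    rewrite lerXn2r ?nnegrE//; last by rewrite mulr_ge0 ?(ltW r0) ?(ltW P0).
    by rewrite mulr_ge0// mulr_ge0// ltW.
  have -> : ((4 * (pow2 j%:~R * Num.sqrt A1)) ^+ 2 = (16 * A1) * P)%R.
    by rewrite !exprMn sqr_sqrtr// -pE; ring.
  have -> : ((r * P) ^+ 2 = r ^+ 2 * P * P)%R by ring.
  by rewrite ler_pM2r.
have e1 : (2 * A0 / r <= P / 2)%R by rewrite ler_pdivrMr//; lra.
have e2 : (4 * A1 / r ^+ 2 <= P / 4)%R.
  by rewrite ler_pdivrMr ?exprn_gt0//; lra.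
lra.
Qed.

End level_sums.

(** * Discretization of the interpolation norm *)

Section dyadic_interpolation_norm.
Local Open Scope ereal_scope.
Context {R : realType} {V : zmodType}.
Variables (X0 X1 : normed_subspace R V).
Hypotheses (X0_ge0 : forall a, 0 <= nsnorm X0 a)
           (X1_ge0 : forall a, 0 <= nsnorm X1 a).

Lemma K_functional_ge0 (t : R) a : (0 <= t)%R -> 0 <= K_functional X0 X1 t a.
Proof.
move=> t0; apply: le_ereal_inf_tmp => _ [a0 [a1 [_ _ _ ->]]].
by rewrite adde_ge0 ?mule_ge0// lee_fin.
Qed.

Lemma K_functional_nondecreasing a (t t' : R) : (t <= t')%R ->
  K_functional X0 X1 t a <= K_functional X0 X1 t' a.
Proof.
move=> tt'; apply: le_ereal_inf_tmp => _ [a0 [a1 [X0a0 X1a1 aE ->]]].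
apply: le_trans (_ : nsnorm X0 a0 + t%:E * nsnorm X1 a1 <= _).
  by apply: ereal_inf_lbound; exists a0, a1.
by apply: leeD => //; apply: lee_wpmul2r.
Qed.

(** The superlevel sets of a monotone function are intervals. *)
Lemma measurable_K_functional a (D : set R) : measurable D ->
  measurable_fun D (fun t => K_functional X0 X1 t a).
Proof.
move=> mD; apply: (measurability _ (ErealGenCInfty.measurableE R)) => //.
move=> _ [_ [r ->] <-]; apply: measurableI => //.
apply: is_interval_measurable => x y /=; rewrite !in_itv/= !andbT => rx _ z.
by move=> /andP[xz _]; rewrite in_itv/= andbT (le_trans rx)// K_functional_nondecreasing.
Qed.

Definition dyadic_block (k : int) : set R :=
  `](pow2 k%:~R), (pow2 (k + 1)%:~R)]%classic.

Lemma measurable_dyadic_block k : measurable (dyadic_block k).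
Proof. exact: measurable_itv. Qed.

Lemma dyadic_block_gt0 k t : dyadic_block k t -> (0 < t)%R.
Proof.
rewrite /dyadic_block/= in_itv/= => /andP[kt _].
by rewrite (lt_trans _ kt)// pow2_gt0.
Qed.

Lemma integral_dyadic (f : R -> \bar R) :
  measurable_fun (`]0%R, +oo[%classic : set R) f ->
  (forall t, (0 < t)%R -> 0 <= f t) ->
  \int[lebesgue_measure]_(t in `]0%R, +oo[%classic) f t =
  \total_(k : int) \int[lebesgue_measure]_(t in dyadic_block k) f t.
Proof.
move=> mf f0.
(* The blocks are enumerated through the injection of Z into nat; the naturals
   outside its range get the empty set. *)
pose F n := if pickle_inv n is Some k then dyadic_block k else set0.
have UF : `]0%R, +oo[%classic = \bigcup_n F n :> set R.
  apply/seteqP; split => [t/=|t [n _]].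
    rewrite in_itv/= andbT => t0.
    have [k] := @pow2_bracket R t 1 ltr01 t0; rewrite !mul1r => kt.
    exists (pickle k); first by [].
    by rewrite /F pickleK_inv /dyadic_block/= in_itv/= kt.
  rewrite /F; case: pickle_inv => // k /dyadic_block_gt0.
  by rewrite /= in_itv/= andbT.
have mF n : measurable (F n).
  rewrite /F; case: pickle_inv => [k|]; last exact: measurable0.
  exact: measurable_dyadic_block.
have tF : trivIset setT F.
  apply/trivIsetP => n n' _ _ nn'; apply/seteqP; split => // t [].
  rewrite /F; case E: (pickle_inv n) => [k|]//; case E' : (pickle_inv n') => [k'|]//.
  rewrite /dyadic_block/= !in_itv/= => /andP[kt tk] /andP[kt' tk'].
  move/eqP: nn'; apply.
  have lt1 : (k < k' + 1)%R by rewrite -(ltr_int R) -ltr_pow2 (lt_le_trans kt).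
  have lt2 : (k' < k + 1)%R by rewrite -(ltr_int R) -ltr_pow2 (lt_le_trans kt').
  have kk' : k = k' by lia.
  have := @pickle_invK int n; rewrite E/= => <-.
  by have := @pickle_invK int n'; rewrite E'/= kk'.
rewrite UF ge0_integral_bigcup//; last 2 first.
- by rewrite -UF.
- by rewrite -UF => t /=; rewrite in_itv/= andbT => /f0.
have I0 k : 0 <= \int[lebesgue_measure]_(t in dyadic_block k) f t.
  by apply: integral_ge0 => t /dyadic_block_gt0/f0.
rewrite nneseries_esumT; last first.
  move=> n; rewrite /F; case: pickle_inv => [k|]; first exact: I0.
  by rewrite integral_set0.
transitivity (\esum_(n in (@pickle int) @` setT)
    \int[lebesgue_measure]_(t in F n) f t).
  rewrite [RHS]esum_mkcond; apply: eq_esum => n _; case: ifPn => //.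
  rewrite notin_setE => nimg; rewrite /F; case E: (pickle_inv n) => [k|].
    by case: nimg; exists k => //; have := @pickle_invK int n; rewrite E.
  by rewrite integral_set0.
rewrite esum_image; last by move=> k k' _ _; exact: (pcan_inj pickleK).
by apply: eq_esum => k _; rewrite /F pickleK_inv.
Qed.

Lemma lebesgue_dyadic_block k :
  lebesgue_measure (dyadic_block k) = (pow2 k%:~R)%:E :> \bar R.
Proof.
rewrite /dyadic_block lebesgue_measure_itv/= lte_fin ltr_pow2 ltr_int ltrDl/=.
rewrite -EFinB intrD1 pow2D pow2_1; congr (_%:E); ring.
Qed.

Variables (theta p : R).
Hypotheses (theta_ge0 : (0 <= theta)%R) (p_gt0 : (0 < p)%R).

Definition dyadic_K_sum a : \bar R :=
  \total_(k : int) ((pow2 (- (theta * p * k%:~R)))%:E *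
                    K_functional X0 X1 (pow2 k%:~R) a `^ p).

Let g a (t : R) : \bar R :=
  ((t `^ (- theta))%:E * K_functional X0 X1 t a) `^ p * (t^-1)%:E.

Let g_ge0 a t : (0 < t)%R -> 0 <= g a t.
Proof. by move=> t0; rewrite mule_ge0 ?poweR_ge0// lee_fin invr_ge0 ltW. Qed.

Let measurable_g a : measurable_fun (`]0%R, +oo[%classic : set R) (g a).
Proof.
apply: emeasurable_funM.
  apply: (measurableT_comp (measurable_poweR _)).
  apply: emeasurable_funM; last exact: measurable_K_functional.
  by apply/measurable_EFinP/measurable_funTS; exact: measurable_powR.
apply/measurable_EFinP.
apply: (eq_measurable_fun (fun t : R => t `^ (-1))%R) => [t|].
  by rewrite inE/= in_itv/= andbT => t0; rewrite powR_inv1// ltW.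
by apply: measurable_funTS; exact: measurable_powR.
Qed.

Let measurable_g_block a k : measurable_fun (dyadic_block k) (g a).
Proof.
apply: (measurable_funS _ _ (measurable_g a)) => // t.
by move=> /dyadic_block_gt0; rewrite /= in_itv/= andbT.
Qed.

(** The factor t^(- theta p - 1) decreases and K increases, so freezing each at
one endpoint of the block bounds the integrand from both sides. *)
Let block_bounds a k t : dyadic_block k t ->
  (pow2 (- (theta * p * (k + 1)%:~R) - (k + 1)%:~R))%:E *
     K_functional X0 X1 (pow2 k%:~R) a `^ p <= g a t <=
  (pow2 (- (theta * p * k%:~R) - k%:~R))%:E *
     K_functional X0 X1 (pow2 (k + 1)%:~R) a `^ p.
Proof.
rewrite /dyadic_block/= in_itv/= => /andP[kt tk].
have t0 : (0 < t)%R by rewrite (lt_trans _ kt)// pow2_gt0.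
have K0 x : (0 <= x)%R -> 0 <= K_functional X0 X1 x a by exact: K_functional_ge0.
have split_pow (x : R) K : 0 <= K ->
  (pow2 (- (theta * p * x) - x))%:E * K `^ p =
    ((pow2 x `^ (- theta))%:E * K) `^ p * ((pow2 x)^-1)%:E.
  move=> K1; rewrite poweRM ?lee_fin ?powR_ge0// poweR_EFin !pow2M -pow2N.
  rewrite pow2D muleAC -EFinM; congr ((_ * _)%:E * _); congr (pow2 _); ring.
have powN x y : (0 < x)%R -> (x <= y)%R -> (y `^ (- theta) <= x `^ (- theta))%R.
  move=> x0 xy; rewrite !powRN lef_pV2 ?posrE ?powR_gt0 ?(lt_le_trans x0)//.
  by rewrite ge0_ler_powR ?nnegrE// ?(ltW x0)// ltW// (lt_le_trans x0).
rewrite !split_pow ?K0 ?pow2_ge0//; apply/andP; split.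
  apply: lee_pmul; rewrite ?poweR_ge0//.
  - by rewrite lee_fin invr_ge0 pow2_ge0.
  - apply: lee_poweR; first exact: ltW.
      by rewrite mule_ge0 ?K0 ?pow2_ge0// lee_fin powR_ge0.
    apply: lee_pmul; rewrite ?K0 ?pow2_ge0 ?lee_fin ?powR_ge0//.
      exact: powN.
    by apply: K_functional_nondecreasing; exact: ltW.
  - by rewrite lee_fin lef_pV2 ?posrE ?pow2_gt0.
apply: lee_pmul; rewrite ?poweR_ge0//.
- by rewrite lee_fin invr_ge0 ltW.
- apply: lee_poweR; first exact: ltW.
    by rewrite mule_ge0 ?K0 ?(ltW t0)// lee_fin powR_ge0.
  apply: lee_pmul; rewrite ?K0 ?(ltW t0) ?lee_fin ?powR_ge0//.
    by apply: powN; rewrite ?pow2_gt0 ?(ltW kt).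
  exact: K_functional_nondecreasing.
- by rewrite lee_fin lef_pV2 ?posrE ?pow2_gt0// ltW.
Qed.

Lemma integral_le_dyadic_K_sum a :
  \int[lebesgue_measure]_(t in `]0%R, +oo[%classic) g a t <=
  (pow2 (theta * p))%:E * dyadic_K_sum a.
Proof.
rewrite integral_dyadic; [|exact: measurable_g|exact: g_ge0].
have K0 k : 0 <= K_functional X0 X1 (pow2 k%:~R) a `^ p by exact: poweR_ge0.
rewrite -totalZl ?pow2_ge0//; last by move=> k; rewrite mule_ge0// lee_fin pow2_ge0.
rewrite [leRHS](@total_bij _ _ _ (fun j : int => j + 1)%R); last first.
  by exists (fun j : int => j - 1)%R => k; rewrite ?subrK ?addrK.
apply: le_esum => k _.
set B := (pow2 (- (theta * p * k%:~R) - k%:~R))%:E *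
     K_functional X0 X1 (pow2 (k + 1)%:~R) a `^ p.
apply: (@le_trans _ _ (\int[lebesgue_measure]_(t in dyadic_block k) cst B t)).
  apply: ge0_le_integral => //; first exact: measurable_dyadic_block.
  - by move=> t /dyadic_block_gt0; exact: g_ge0.
  - exact: measurable_g_block.
  - by move=> t /(@block_bounds a)/andP[].
rewrite integral_cst; last exact: measurable_dyadic_block.
  rewrite [X in _ * X]lebesgue_dyadic_block muleAC muleA -!EFinM.
rewrite -!pow2D lee_wpmul2r// lee_fin ler_pow2 intrD1; lra.
Qed.

Lemma dyadic_K_sum_le_integral a : dyadic_K_sum a <=
  (pow2 (theta * p + 1))%:E *
  \int[lebesgue_measure]_(t in `]0%R, +oo[%classic) g a t.
Proof.
rewrite integral_dyadic; [|exact: measurable_g|exact: g_ge0].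
have K0 k : 0 <= K_functional X0 X1 (pow2 k%:~R) a `^ p by exact: poweR_ge0.
rewrite -totalZl ?pow2_ge0//; last first.
  by move=> k; apply: integral_ge0 => t /dyadic_block_gt0; exact: g_ge0.
apply: le_esum => k _.
set B := (pow2 (- (theta * p * (k + 1)%:~R) - (k + 1)%:~R))%:E *
     K_functional X0 X1 (pow2 k%:~R) a `^ p.
apply: (@le_trans _ _ ((pow2 (theta * p + 1))%:E *
   \int[lebesgue_measure]_(t in dyadic_block k) cst B t)).
  rewrite integral_cst; last exact: measurable_dyadic_block.
  rewrite [X in _ * (_ * X)]lebesgue_dyadic_block (muleAC _ _ (pow2 _)%:E) !muleA -!EFinM.
  rewrite -!pow2D lee_wpmul2r// lee_fin ler_pow2 intrD1; lra.
apply: lee_wpmul2l; first by rewrite lee_fin pow2_ge0.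
apply: ge0_le_integral => //; first exact: measurable_dyadic_block.
- by move=> t _; rewrite mule_ge0// lee_fin pow2_ge0.
- exact: measurable_g_block.
- by move=> t /(@block_bounds a)/andP[].
Qed.

End dyadic_interpolation_norm.

(** * Interpolation of the weighted sequence spaces *)

Section weighted_interpolation.
Local Open Scope ereal_scope.
Context {R : realType} {I : choiceType} (m : nat) (lam : I -> R[i]).
Context {n : nat} (Omega : set 'rV[R]_n) (u : I -> 'rV[R]_n -> R[i]).
Variable w : I -> R.
Hypotheses (w_gt0 : forall i, (0 < w i)%R)
           (wE : forall i, Linfty_norm Omega (u i) = (w i)%:E).

Let mu i : R := (w i ^+ 2)%R.
Let b (a : I -> R[i]) i : R := (normc (a i) / w i)%R.

Let mu_gt0 i : (0 < mu i)%R. Proof. exact: exprn_gt0. Qed.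

Lemma normc_ge0 (z : R[i]) : (0 <= normc z)%R.
Proof. by case: z => x y; exact: sqrtr_ge0. Qed.

Let b_ge0 a i : (0 <= b a i)%R.
Proof. by rewrite divr_ge0 ?normc_ge0// ltW. Qed.

Let bD a0 a1 i : (b (a0 + a1)%R i <= b a0 i + b a1 i)%R.
Proof.
rewrite /b -mulrDl ler_wpM2r//; first by rewrite invr_ge0 ltW.
exact: le_normcD.
Qed.

(** The change of variables: |a|^q w^(2 - q) = w^2 (|a| / w)^q. *)
Let lp_normE (q : R) a : lp_norm Omega u q a = wsum mu (b a) q `^ q^-1.
Proof.
rewrite /lp_norm /wsum; congr (_ `^ _); apply: eq_esum => i _.
rewrite wE poweR_EFin -EFinM; congr (_%:E).
have wN0 : (w i != 0)%R by rewrite gt_eqF.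
rewrite /mu /b powRM ?normc_ge0 ?invr_ge0 ?(ltW (w_gt0 i))//.
rewrite -powR_inv1 ?(ltW (w_gt0 i))// -powRrM mulN1r.
by rewrite powRB ?wN0 ?implybT// powR_mulrn ?(ltW (w_gt0 i))// powRN mulrCA.
Qed.

Let lp_norm_fin (q : R) a : (0 < q)%R ->
  (lp_norm Omega u q a < +oo) = (wsum mu (b a) q < +oo).
Proof.
move=> q0; rewrite lp_normE; apply/idP/idP; last exact: poweR_lty.
by apply: lty_poweRy; rewrite invr_eq0 gt_eqF.
Qed.

Let jbracket_ge1 i : (1 <= jbracket m lam i)%R.
Proof.
rewrite /jbracket -[leLHS](powRr0 (1 + normc (lam i) ^+ 2)).
by rewrite ler_powR ?invr_ge0// lerDl exprn_ge0// normc_ge0.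
Qed.

Let temperedD a0 a1 : tempered m lam a0 -> tempered m lam a1 ->
  tempered m lam (a0 + a1)%R.
Proof.
move=> [C0 [M0 h0]] [C1 [M1 h1]].
exists (`|C0| + `|C1|)%R, (Num.max M0 M1) => i.
apply: (le_trans (le_normcD _ _)); rewrite mulrDl.
have ge0 x : (0 <= jbracket m lam i `^ x)%R by exact: powR_ge0.
apply: lerD.
  apply: (le_trans (h0 i)); apply: (@le_trans _ _ (`|C0| * jbracket m lam i `^ M0)%R).
    by rewrite ler_wpM2r// ler_norm.
  by rewrite ler_wpM2l// ler_powR// le_max lexx.
apply: (le_trans (h1 i)); apply: (@le_trans _ _ (`|C1| * jbracket m lam i `^ M1)%R).
  by rewrite ler_wpM2r// ler_norm.
by rewrite ler_wpM2l// ler_powR// le_max lexx orbT.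
Qed.

Let cut (P : pred I) (a : I -> R[i]) i : R[i] := if P i then a i else 0%R.

Let temperedI P a : tempered m lam a -> tempered m lam (cut P a).
Proof.
move=> [C [M h]]; exists C, M => i; rewrite /cut; case: ifP => // _.
by rewrite ComplexField.Normc.normc0 (le_trans _ (h i))// normc_ge0.
Qed.

Let cut_split P a : a = (cut P a + cut (fun i => ~~ P i) a)%R.
Proof.
by apply/funext => i; rewrite /cut fctE; case: (P i); rewrite ?addr0 ?add0r.
Qed.

Let wsum_cut P a (q : R) : (0 < q)%R -> wsum mu (b (cut P a)) q =
  \total_(i : I) (mu i * (b a i `^ q * (P i)%:R))%:E.
Proof.
move=> q0; apply: eq_esum => i _; rewrite /b /cut; case: (P i).
  by rewrite mulr1.
by rewrite ComplexField.Normc.normc0 mul0r powR0 ?gt_eqF// !mulr0.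
Qed.

Lemma poweRD_le (x y : \bar R) (q : R) : (0 < q)%R -> 0 <= x -> 0 <= y ->
  (x + y) `^ q <= (pow2 q)%:E * (x `^ q + y `^ q).
Proof.
move=> q0; wlog xy : x y / x <= y.
  move=> h x0 y0; have [xy|/ltW yx] := leP x y; first exact: h.
  by rewrite addeC (addeC (x `^ q)) h.
move=> x0 y0; apply: (@le_trans _ _ ((2%:E * y) `^ q)).
  apply: lee_poweR; [exact: ltW|exact: adde_ge0|].
  by rewrite mule_natl mule2n leeD2r.
rewrite poweRM// poweR_EFin; apply: lee_wpmul2l; first by rewrite lee_fin powR_ge0.
by rewrite leeDr// poweR_ge0.
Qed.

(** b <= b^p where b > 1, and b^2 <= b^p where b <= 1: hence l^p is contained
in l^1 + l^2. *)
Let truncation (p : R) a : (1 <= p)%R -> (p <= 2)%R ->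
  wsum mu (b (cut (fun i => 1 < b a i)%R a)) 1 <= wsum mu (b a) p /\
  wsum mu (b (cut (fun i => ~~ (1 < b a i)%R) a)) 2 <= wsum mu (b a) p.
Proof.
move=> p1 p2; rewrite !wsum_cut//.
split; apply: le_esum => i _; rewrite lee_fin ler_wpM2l ?(ltW (mu_gt0 i))//.
  by case: ltP => b1; rewrite ?mulr0 ?powR_ge0// mulr1 ler_powR// ltW.
case: ltP => b1; rewrite ?mulr0 ?powR_ge0// mulr1.
have := b_ge0 a i; rewrite le_eqVlt => /predU1P[<-|b0].
  by rewrite !powR0// gt_eqF//; lra.
by rewrite ger_powR// b0.
Qed.

Let l1 := lp m lam Omega u 1.
Let l2 := lp m lam Omega u 2.

Let levels_of_decomposition a a0 a1 : a = (a0 + a1)%R ->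
  wsum mu (b a0) 1 < +oo -> wsum mu (b a1) 2 < +oo ->
  (exists s, levels mu (b a) s) /\
  (forall r, (0 < r)%R -> tail_mass mu (b a) r < +oo).
Proof.
move=> aE; have := wsum_ge0 (b a0) 1 mu_gt0; have := wsum_ge0 (b a1) 2 mu_gt0.
case E0 : (wsum mu (b a0) 1) => [A0||]//; case E1 : (wsum mu (b a1) 2) => [A1||]//.
rewrite !lee_fin => A10 A00 _ _.
have tl r : (0 < r)%R ->
    tail_mass mu (b a) r <= (2 * A0 / r + 4 * A1 / r ^+ 2)%:E.
  apply: (@tail_mass_sum_le _ _ mu (b a) (b a0) (b a1)) => //.
  - by move=> i; rewrite aE; exact: bD.
  - by rewrite E0.
  - by rewrite E1.
split; last by move=> r /tl /le_lt_trans; apply; rewrite ltry.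
by apply: (levels_exist mu_gt0 _ _ tl); rewrite mulr_ge0.
Qed.

Section exponents.
Variables (theta : R).
Hypotheses (theta_gt0 : (0 < theta)%R) (theta_lt1 : (theta < 1)%R).
Let p : R := (2 / (2 - theta))%R.

Let d_gt0 : (0 < 2 - theta)%R. Proof. by have := theta_lt1; lra. Qed.
Let p_gt1 : (1 < p)%R.
Proof. by rewrite /p ltr_pdivlMr// mul1r; have := theta_gt0; lra. Qed.
Let p_lt2 : (p < 2)%R.
Proof. by rewrite /p ltr_pdivrMr//; have := theta_lt1; lra. Qed.
Let p_gt0 : (0 < p)%R. Proof. by have := p_gt1; lra. Qed.
Let theta_p : (theta * p = 2 * p - 2)%R.
Proof. by rewrite /p; field; rewrite gt_eqF. Qed.

Let l1_ge0 a : 0 <= nsnorm l1 a. Proof. exact: poweR_ge0. Qed.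
Let l2_ge0 a : 0 <= nsnorm l2 a. Proof. exact: poweR_ge0. Qed.

Let l1_normE a : nsnorm l1 a = wsum mu (b a) 1.
Proof. by rewrite /= lp_normE invr1 poweRe1// wsum_ge0. Qed.

Let l2_normE a : nsnorm l2 a = wsum mu (b a) 2 `^ 2^-1.
Proof. by rewrite /= lp_normE. Qed.

(** If one of the two pieces of a has infinite norm, the right-hand side is
infinite; otherwise they form an admissible decomposition. *)
Let K_functional_le_cut P a (t : R) : (0 < t)%R -> tempered m lam a ->
  K_functional l1 l2 t a <= wsum mu (b (cut P a)) 1 +
    t%:E * wsum mu (b (cut (fun i => ~~ P i) a)) 2 `^ 2^-1.
Proof.
move=> t0 ta.
have w1 := wsum_ge0 (b (cut P a)) 1 mu_gt0.
have w2 := wsum_ge0 (b (cut (fun i => ~~ P i) a)) 2 mu_gt0.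
have [f1|] := ltP (wsum mu (b (cut P a)) 1) +oo; last first.
  by rewrite leye_eq => /eqP ->; rewrite addye ?leey// gt_eqF//
    (lt_le_trans ltNy0)// mule_ge0 ?poweR_ge0// lee_fin ltW.
have [f2|] := ltP (wsum mu (b (cut (fun i => ~~ P i) a)) 2) +oo; last first.
  rewrite leye_eq => /eqP ->; rewrite poweRyr ?invr_eq0 ?pnatr_eq0//.
  by rewrite gt0_muley ?lte_fin// addey ?leey// gt_eqF// (lt_le_trans ltNy0).
apply: ereal_inf_lbound; exists (cut P a), (cut (fun i => ~~ P i) a).
rewrite -l1_normE -l2_normE; split => //.
- by split; [exact: temperedI|rewrite lp_norm_fin].
- by split; [exact: temperedI|rewrite lp_norm_fin].
Qed.

(** The decomposition of a at height s_k is the test for K(2^k). *)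
Let dyadic_K_sum_le : exists2 C : R, (0 < C)%R & forall a,
  tempered m lam a -> wsum mu (b a) p < +oo ->
  dyadic_K_sum l1 l2 theta p a <= C%:E * wsum mu (b a) p.
Proof.
have [A A0 HA] := @high_part_le R I p p_gt1.
have [B B0 HB] := @low_part_le R I p p_gt0 p_lt2.
have [D D0 HD] := @level_sum_le_wsum R I p p_gt0.
exists (pow2 p * (A + B) * D)%R; first by rewrite !mulr_gt0 ?pow2_gt0 ?addr_gt0.
move=> a ta wa.
have [t1 t2] := truncation a (ltW p_gt1) (ltW p_lt2).
have [[s sl] dfin] := levels_of_decomposition (cut_split _ a)
  (le_lt_trans t1 wa) (le_lt_trans t2 wa).
pose hi k := wsum mu (b (cut (fun i => s k < b a i)%R a)) 1.
pose lo k := wsum mu (b (cut (fun i => ~~ (s k < b a i)%R) a)) 2.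
have hi0 k : 0 <= hi k by exact: wsum_ge0.
have lo0 k : 0 <= lo k by exact: wsum_ge0.
have p0 x : 0 <= (pow2 x)%:E :> \bar R by rewrite lee_fin pow2_ge0.
apply: (@le_trans _ _ ((pow2 p)%:E *
   (\total_(k : int) ((pow2 (- ((2 * p - 2) * k%:~R)))%:E * hi k `^ p) +
    \total_(k : int) ((pow2 ((2 - p) * k%:~R))%:E * lo k `^ (p / 2))))).
  rewrite -esumD; last 2 first.
  - by move=> k _; rewrite mule_ge0 ?poweR_ge0.
  - by move=> k _; rewrite mule_ge0 ?poweR_ge0.
  rewrite -totalZl ?pow2_ge0//; last first.
    by move=> k; rewrite adde_ge0 ?mule_ge0 ?poweR_ge0.
  apply: le_esum => k _.
  have Kle := @K_functional_le_cut (fun i => s k < b a i)%R a _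
    (pow2_gt0 k%:~R) ta.
  have K0 : 0 <= K_functional l1 l2 (pow2 k%:~R) a.
    by apply: K_functional_ge0 => //; exact: pow2_ge0.
  apply: le_trans (lee_wpmul2l (p0 _) (lee_poweR (ltW p_gt0) K0 Kle)) _.
  rewrite -/(hi k) -/(lo k).
  apply: le_trans (lee_wpmul2l (p0 _) (poweRD_le p_gt0 (hi0 k) _)) _.
    by rewrite mule_ge0 ?poweR_ge0.
  rewrite muleCA; apply: lee_wpmul2l => //.
  rewrite poweRM ?poweR_ge0// poweR_EFin pow2M -poweRrM.
  rewrite ge0_muleDr ?mule_ge0 ?poweR_ge0// theta_p muleA -EFinM -pow2D.
  rewrite (mulrC 2^-1%R); apply: leeD => //; apply: lee_wpmul2r.
    exact: poweR_ge0.
  by rewrite lee_fin ler_pow2; lra.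
rewrite !EFinM -!muleA; apply: lee_wpmul2l => //.
apply: (@le_trans _ _ ((A + B)%:E * level_sum s p)); last first.
  by apply: lee_wpmul2l; [rewrite lee_fin addr_ge0// ltW|exact: HD].
rewrite EFinD ge0_muleDl ?lee_fin ?(ltW A0) ?(ltW B0)//; apply: leeD.
  apply: le_trans (HA mu (b a) s mu_gt0 (b_ge0 a) sl).
  by apply: le_esum => k _; rewrite /hi wsum_cut.
apply: le_trans (HB mu (b a) s mu_gt0 (b_ge0 a) dfin sl).
apply: le_esum => k _; rewrite /lo wsum_cut//.
by under eq_esum do rewrite -leNgt.
Qed.

Let wsum_le_dyadic_K_sum a :
  (exists a0 a1, [/\ carrier l1 a0, carrier l2 a1 & a = a0 + a1]%R) ->
  wsum mu (b a) p <= (pow2 (2 + 2 * p))%:E * dyadic_K_sum l1 l2 theta p a.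
Proof.
move=> [a0 [a1 [[_ f0] [_ f1] aE]]].
rewrite !lp_norm_fin// in f0 f1.
have [[s sl] dfin] := levels_of_decomposition aE f0 f1.
apply: le_trans (wsum_le_level_sum mu_gt0 (b_ge0 a) dfin sl p_gt0) _.
rewrite (pow2D 2 (2 * p)) EFinM -muleA; apply: lee_wpmul2l; first by rewrite lee_fin pow2_ge0.
rewrite -totalZl ?pow2_ge0//; last first.
  by move=> k; rewrite mule_ge0 ?poweR_ge0// lee_fin pow2_ge0.
apply: le_esum => j _.
set K := K_functional _ _ _ _.
have K0 : 0 <= K by apply: K_functional_ge0 => //; exact: pow2_ge0.
have sK : (s j)%:E <= (pow2 (2 - 2 * j%:~R))%:E * K.
  rewrite -lee_pdivrMl ?pow2_gt0//; apply: le_ereal_inf_tmp.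
  move=> _ [c0 [c1 [_ _ cE ->]]]; rewrite lee_pdivrMl ?pow2_gt0//.
  rewrite l1_normE l2_normE.
  have := @level_le_decomposition R I mu (b a) s (b c0) (b c1) j mu_gt0
    (b_ge0 c0) (b_ge0 c1) _ sl.
  rewrite (pow2D 2) (_ : pow2 2 = 4%R); first by apply => i; rewrite cE; exact: bD.
  by rewrite /pow2 powR_mulrn//; ring.
have s0 : 0 <= (s j)%:E by rewrite lee_fin (level_ge0 sl).
have := lee_poweR (ltW p_gt0) s0 sK.
rewrite poweRM ?lee_fin ?pow2_ge0// !poweR_EFin pow2M => sKp.
rewrite EFinM; apply: le_trans (lee_wpmul2l _ sKp) _.
  by rewrite lee_fin pow2_ge0.
rewrite !muleA -!EFinM -!pow2D; apply: lee_wpmul2r; first exact: poweR_ge0.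
by rewrite lee_fin ler_pow2 theta_p; lra.
Qed.

(** The two bounds on the dyadic sum of K, raised to the power 1/p.  The
tempered growth condition is stable under sums and restrictions, so it is the
same for both spaces. *)
Lemma lp_real_interpolation :
  equal_with_equivalent_norms (real_interpolation theta p l1 l2)
    (lp m lam Omega u p).
Proof.
have [C C0 HC] := dyadic_K_sum_le.
have pI0 : (0 <= p^-1)%R by rewrite invr_ge0 ltW.
have int_le a := integral_le_dyadic_K_sum l1_ge0 l2_ge0 (ltW theta_gt0) p_gt0 a.
have le_int a := dyadic_K_sum_le_integral l1_ge0 l2_ge0 (ltW theta_gt0) p_gt0 a.
pose A := (pow2 (theta * p) * C)%R.
pose B := (pow2 (2 + 2 * p) * pow2 (theta * p + 1))%R.
have A0 : (0 < A)%R by rewrite mulr_gt0 ?pow2_gt0.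
have B0 : (0 < B)%R by rewrite mulr_gt0 ?pow2_gt0.
have upper a : carrier (lp m lam Omega u p) a ->
    interpolation_norm theta p l1 l2 a <= (A `^ p^-1)%:E * lp_norm Omega u p a.
  move=> [ta]; rewrite lp_norm_fin// => fa.
  rewrite lp_normE -poweR_EFin -poweRM ?lee_fin ?(ltW A0) ?wsum_ge0//.
  apply: lee_poweR => //.
    apply: integral_ge0 => t; rewrite /= in_itv/= andbT => t0.
    by rewrite mule_ge0 ?poweR_ge0// lee_fin invr_ge0 ltW.
  apply: (le_trans (int_le a)); rewrite EFinM -muleA.
  by apply: lee_wpmul2l; [rewrite lee_fin pow2_ge0|exact: HC].
have lower a : carrier (real_interpolation theta p l1 l2) a ->
    lp_norm Omega u p a <= (B `^ p^-1)%:E * interpolation_norm theta p l1 l2 a.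
  move=> [sa _]; rewrite lp_normE -poweR_EFin -poweRM ?lee_fin ?(ltW B0)//; last first.
    apply: integral_ge0 => t; rewrite /= in_itv/= andbT => t0.
    by rewrite mule_ge0 ?poweR_ge0// lee_fin invr_ge0 ltW.
  apply: lee_poweR => //; first exact: wsum_ge0.
  apply: (le_trans (wsum_le_dyadic_K_sum sa)); rewrite EFinM -muleA.
  by apply: lee_wpmul2l; [rewrite lee_fin pow2_ge0|exact: le_int].
have fin_mul (x : R) (y : \bar R) : 0 <= y -> y < +oo -> x%:E * y < +oo.
  by case: y => // r _ _; rewrite -EFinM ltry.
have carrierE : carrier (real_interpolation theta p l1 l2) =
    carrier (lp m lam Omega u p).
  apply/seteqP; split => a.
    move=> ca; have [[a0 [a1 [[t0 _] [t1 _] aE]]] fa] := ca; split.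
      by rewrite aE; exact: temperedD.
    by apply: le_lt_trans (lower a ca) _; rewrite fin_mul// poweR_ge0.
  move=> ca; have [ta fa] := ca; split; last first.
    by apply: le_lt_trans (upper a ca) _; rewrite fin_mul// poweR_ge0.
  rewrite lp_norm_fin// in fa.
  have [t1 t2] := truncation a (ltW p_gt1) (ltW p_lt2).
  exists (cut (fun i => 1 < b a i)%R a), (cut (fun i => ~~ (1 < b a i)%R) a).
  split; last exact: cut_split.
    split; first exact: temperedI.
    by rewrite lp_norm_fin//; exact: le_lt_trans t1 fa.
  split; first exact: temperedI.
  by rewrite lp_norm_fin//; exact: le_lt_trans t2 fa.
split => //; exists (A `^ p^-1 + B `^ p^-1)%R.
  by rewrite addr_gt0 ?powR_gt0.
move=> a ca; have ca' : carrier (lp m lam Omega u p) a by rewrite -carrierE.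
split.
  apply: (le_trans (upper a ca')); apply: lee_wpmul2r; first exact: poweR_ge0.
  by rewrite lee_fin lerDl powR_ge0.
apply: (le_trans (lower a ca)); apply: lee_wpmul2r; first exact: poweR_ge0.
by rewrite lee_fin lerDr powR_ge0.
Qed.

End exponents.
End weighted_interpolation.

(** * Positivity of the essential bounds *)

Section essential_bound_positive.
Context {R : realType} {n : nat} (Omega : set 'rV[R]_n).
Hypothesis Omega_open : open Omega.
Implicit Types f g : 'rV[R]_n -> R[i].

Lemma normc_le0_eq0 (z : R[i]) : normc z <= 0 -> z = 0.
Proof.
move=> z0; apply: ComplexField.Normc.eq0_normc; apply/eqP; rewrite eq_le z0.
by case: z z0 => x y _; exact: sqrtr_ge0.
Qed.

Lemma Linfty_norm_le0 f : (Linfty_norm Omega f <= 0)%E -> eq_ae Omega f (cst 0).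
Proof.
move=> /ess_supP; apply: filterS => x fx Ox; apply: normc_le0_eq0.
by move: fx; rewrite patchE mem_set.
Qed.

Lemma cintegral_ae0 f :
  measurable_fun Omega (fun x => complex.Re (f x)) ->
  measurable_fun Omega (fun x => complex.Im (f x)) ->
  eq_ae Omega f (cst 0) -> cintegral Omega f = 0.
Proof.
move=> mRe mIm f0.
have mO : measurable Omega by exact: sub_sigma_algebra.
have int0 (h : R[i] -> R) : h 0 = 0 -> measurable_fun Omega (h \o f) ->
    Rintegral (lebesgue_rV R n) Omega (h \o f) = 0.
  move=> h0 mh; rewrite /Rintegral (ae_eq_integral (cst 0%E))//.
  - by rewrite integral0.
  - exact/measurable_EFinP.
  - by apply: filterS f0 => x fx Ox; rewrite /= fx// h0.
by rewrite /cintegral (int0 (@complex.Re R))// (int0 (@complex.Im R)).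
Qed.

(** A function with zero essential bound vanishes almost everywhere, and so
does its product with any other. *)
Lemma Linfty_norm_gt0 f g : L2 Omega f -> L2 Omega g ->
  inner Omega f g != 0 ->
  (0 < Linfty_norm Omega f)%E /\ (0 < Linfty_norm Omega g)%E.
Proof.
move=> [mRf mIf _] [mRg mIg _] fg0.
have mRe : measurable_fun Omega (fun x => complex.Re (f x * conjc (g x))).
  apply: (eq_measurable_fun (fun x => complex.Re (f x) * complex.Re (g x) +
      complex.Im (f x) * complex.Im (g x))).
    by move=> x _; case: (f x) (g x) => [a b] [c d] /=; ring.
  by apply: measurable_funD; apply: measurable_funM.
have mIm : measurable_fun Omega (fun x => complex.Im (f x * conjc (g x))).
  apply: (eq_measurable_fun (fun x => complex.Im (f x) * complex.Re (g x) -
      complex.Re (f x) * complex.Im (g x))).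
    by move=> x _; case: (f x) (g x) => [a b] [c d] /=; ring.
  by apply: measurable_funB; apply: measurable_funM.
split; rewrite ltNge; apply: contra fg0 => /Linfty_norm_le0 ae0; apply/eqP;
    apply: cintegral_ae0 => //; apply: filterS ae0 => x h /h /= ->.
  by rewrite mul0r.
by rewrite conjc0 mulr0.
Qed.

End essential_bound_positive.

(** * The interpolation identity for the eigenfunction systems *)

Lemma weights_of_norms (R : realType) (I : choiceType) (N : I -> \bar R) :
  (forall i, 0 < N i < +oo)%E ->
  exists w : I -> R, (forall i, 0 < w i) /\ (forall i, N i = (w i)%:E).
Proof.
move=> N0; have NE i : N i = (fine (N i))%:E.
  by have /andP[N_gt0 Nfin] := N0 i; rewrite fineK// ge0_fin_numE// ltW.
exists (fun i => fine (N i)); split=> // i.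
by rewrite -lte_fin -NE; have /andP[] := N0 i.
Qed.

Theorem corollary7p4 (R : realType)
    (n : nat) (n_gt0 : (0 < n)%N)
    (Omega : set 'rV[R]_n) (Omega_open : open Omega)
    (Omega_bounded : bounded_set Omega)
    (m : nat) (m_gt0 : (0 < m)%N)
    (coef : mindex n m -> 'rV[R]_n -> R[i])
    (L : operator R n)
    (L_linear : linear_operator_L2 Omega L)
    (L_diff : differential_operator Omega coef L)
    (K : nat) (I : set 'rV[int]_K)
    (lam : I -> R[i])
    (L_spectrum : discrete_spectrum Omega L lam)
    (lam_order : forall j k : I,
       \sum_(i < K) (val j ord0 i) ^+ 2 <= \sum_(i < K) (val k ord0 i) ^+ 2 ->
       normc (lam j) <= normc (lam k))
    (u v : I -> 'rV[R]_n -> R[i])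
    (u_eigen : forall xi, eigenfunction Omega L (lam xi) (u xi))
    (v_eigen : forall xi,
       eigenfunction Omega (adjoint Omega L) (conjc (lam xi)) (v xi))
    (u_norm1 : forall xi, l2norm Omega (u xi) = 1)
    (uv_biorth : forall xi eta,
       inner Omega (u xi) (v eta) = if xi == eta then 1 else 0)
    (u_riesz : riesz_basis Omega u) (v_riesz : riesz_basis Omega v)
    (L_complete : complete_dom_infty Omega L)
    (Lstar_complete : complete_dom_infty Omega (adjoint Omega L))
    (u_bounded : forall xi, (Linfty_norm Omega (u xi) < +oo)%E)
    (v_bounded : forall xi, (Linfty_norm Omega (v xi) < +oo)%E)
    (theta : R) (theta_gt0 : 0 < theta) (theta_lt1 : theta < 1) :
  let p := 2 / (2 - theta) in
  let lpL := lp m lam Omega u in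
  let lpLstar := lp m lam Omega v in
  [/\ 1 <= p <= 2,
      equal_with_equivalent_norms
        (real_interpolation theta p (lpL 1) (lpL 2)) (lpL p)
    & equal_with_equivalent_norms
        (real_interpolation theta p (lpLstar 1) (lpLstar 2)) (lpLstar p)].
Proof.
move=> p lpL lpLstar.
have uv_gt0 xi : (0 < Linfty_norm Omega (u xi))%E /\
    (0 < Linfty_norm Omega (v xi))%E.
  have [uL2 _ _] := u_riesz; have [vL2 _ _] := v_riesz.
  apply: (Linfty_norm_gt0 Omega_open (uL2 xi) (vL2 xi)).
  by rewrite uv_biorth eqxx oner_eq0.
have [wu [wu_gt0 wuE]] := @weights_of_norms R I (fun i => Linfty_norm Omega (u i))
  (fun i => introT andP (conj (uv_gt0 i).1 (u_bounded i))).
have [wv [wv_gt0 wvE]] := @weights_of_norms R I (fun i => Linfty_norm Omega (v i))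
  (fun i => introT andP (conj (uv_gt0 i).2 (v_bounded i))).
split; [|exact: (lp_real_interpolation m lam wu_gt0 wuE)
        |exact: (lp_real_interpolation m lam wv_gt0 wvE)].
have d_gt0 : 0 < 2 - theta by lra.
by rewrite /p ler_pdivlMr// ler_pdivrMr//; apply/andP; split; lra.
Qed.
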